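(* Let $\alpha\in\mathbb{R}\setminus\pi\mathbb{Z}$ and $z=\rho i$ with $\rho\in\mathbb{R}\setminus\{0\}$, and let $\mathcal{O}_\alpha$ be the integral transform with parameters $\alpha,z$ defined in the context. For all $f,g\in L^2(\mathbb{R})$, $$\langle \mathcal{O}_\alpha f,\mathcal{O}_\alpha g\rangle=\tfrac14(1+|z|^2)\,\langle f,g\rangle .$$ In the special case $f=g$, $$\|\mathcal{O}_\alpha f\|_2^2=\tfrac14(1+|z|^2)\,\|f\|_2^2 .$$
   Context: For $\alpha\in\mathbb{R}\setminus\pi\mathbb{Z}$ put $a=\frac{\cot\alpha}{2}$ and $c(\alpha)=\sqrt{1-i\cot\alpha}$ (principal square root). For $z=\rho i$, $\rho\in\mathbb{R}\setminus\{0\}$, and $f\in L^1(\mathbb{R})$ (complex-valued), define $$\mathcal{O}_\alpha[f](s)=\frac{c(\alpha)}{\sqrt{2\pi}}\,e^{ias^2}\int_{\mathbb{R}}\frac{e^{-ist\csc\alpha}+z\,e^{ist\csc\alpha}}{2}\,e^{iat^2}f(t)\,dt,\qquad s\in\mathbb{R}.$$ On $L^2(\mathbb{R})$, $\mathcal{O}_\alpha$ denotes the continuous extension of this operator from the Schwartz space $\mathcal{S}(\mathbb{R})$ (equivalently from $L^1\cap L^2$), as for the Fourier transform. The inner product is $\langle f,g\rangle=\int_{\mathbb{R}}f(t)\overline{g(t)}\,dt$ and $\|\cdot\|_2$ is the $L^2(\mathbb{R})$ norm. *)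

(* Defs.v *)
From mathcomp Require Import all_boot all_order all_algebra.
From mathcomp Require Import all_classical all_reals all_analysis.
From mathcomp Require Export complex.

Set Implicit Arguments.
Unset Strict Implicit.
Unset Printing Implicit Defensive.

Import Order.TTheory GRing.Theory Num.Theory.
Import numFieldNormedType.Exports.

Local Open Scope classical_set_scope.
Local Open Scope ring_scope.
Local Open Scope complex_scope.

Section complex_valued_functions.
Context {R : realType}.
Implicit Types f g : R -> R[i].

Definition cmeasurable f :=
  measurable_fun setT (fun t => complex.Re (f t)) /\
  measurable_fun setT (fun t => complex.Im (f t)).

(* The L^p norm of a complex-valued function is that of its modulus. *)
Definition cLnorm (p : \bar R) f : \bar R :=
  Lnorm (@lebesgue_measure R) p (fun t => (Normc.normc (f t))%:E).

(* Membership of functions, not of classes modulo a.e. equality. *)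
Definition in_Lp (p : \bar R) f := cmeasurable f /\ (cLnorm p f < +oo)%E.

Definition cintegral f : R[i] :=
  (\int[@lebesgue_measure R]_t complex.Re (f t)) +i*
  (\int[@lebesgue_measure R]_t complex.Im (f t)).

Definition inner f g : R[i] := cintegral (fun t => f t * (g t)^*%C).

End complex_valued_functions.

Section transform.
Context {R : realType}.
Implicit Types (alpha x : R) (z : R[i]) (f g : R -> R[i]).

Definition expi x : R[i] := cos x +i* sin x.

Definition cot x : R := cos x / sin x.
Definition csc x : R := (sin x)^-1.

(* [sqrtc] is the principal root (nonnegative real part), whereas [sqrtC]
   normalises the imaginary part to be nonnegative, which gives the
   opposite root when [0 < cot alpha]. *)
Definition c_coef alpha : R[i] := sqrtc (1 - 'i%C * (cot alpha)%:C).

(* Meaningful for [f] in L^1. *)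
Definition O_L1 alpha z f : R -> R[i] := fun s =>
  let a := cot alpha / 2 in
  c_coef alpha / (Num.sqrt (2 * pi))%:C * expi (a * s ^+ 2) *
  cintegral (fun t =>
    (expi (- (s * t * csc alpha)) + z * expi (s * t * csc alpha)) / 2 *
    expi (a * t ^+ 2) * f t).

(* [T] is a norm-continuous map from L^2 to L^2 that agrees with the integral
   formula on the dense subspace L^1 /\ L^2; this determines [T] on L^2 up to
   a.e. equality. *)
Definition is_L2_extension alpha z (T : (R -> R[i]) -> (R -> R[i])) :=
  [/\ forall f, in_Lp 2%:E f -> in_Lp 2%:E (T f),
      forall f, in_Lp 2%:E f -> forall e : R, 0 < e ->
        exists2 d : R, 0 < d & forall g, in_Lp 2%:E g ->
          (cLnorm 2%:E (fun t => g t - f t)%R < d%:E)%E ->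
          (cLnorm 2%:E (fun s => T g s - T f s)%R < e%:E)%E
    & forall f, in_Lp 1%:E f -> in_Lp 2%:E f ->
        {ae @lebesgue_measure R, forall s, T f s = O_L1 alpha z f s}].

(* The zero default is only reached if no extension exists; a nontrivial
   identity about [O_L2] thus carries the existence of the extension. *)
Definition O_L2 alpha z : (R -> R[i]) -> (R -> R[i]) :=
  xget (fun _ _ => 0) [set T | is_L2_extension alpha z T].

End transform.

(* Main.v *)
Require Import Defs.
From mathcomp Require Import all_boot all_order all_algebra.
From mathcomp Require Import all_classical all_reals all_analysis.
From mathcomp Require Import complex.
From mathcomp Require Import measurable_realfun ring lra.

(* Write h(t) = e^{iat^2} f(t) and let P, Q be the cosine and sine transforms of
   h at frequency s csc(alpha).  Up to unimodular factors, O f is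
   sqrt(|csc(alpha)| / 8 pi) ((1 + z) P - i (1 - z) Q).  As P is even, Q is odd and
   |1 + z|^2 = |1 - z|^2 = 1 + |z|^2 for imaginary z, the parallelogram law gives
   |O f|^2 = |csc(alpha)| (1 + |z|^2) / (8 pi) (|P|^2 + |Q|^2) after averaging over
   s and -s, so the claim on L^1 /\ L^2 is Plancherel's identity for real h.

   Plancherel is obtained by Abel summation: damping C^2 + S^2 by e^{-e|s|} gives
   the quadratic form of the Poisson kernel 2e / (e^2 + (g x)^2), g = csc(alpha).
   AM-GM bounds this form by (2 pi / |g|) |u|_2^2; as e -> 0 it tends to that value
   when u is continuous, bounded and integrable, and such u are dense.

   The isometry on L^1 /\ L^2 and the completeness of L^2 yield an extension; any
   extension T satisfies |T f + w T g|_2^2 = (1 + |z|^2) / 4 |f + w g|_2^2 for every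
   scalar w by density, and polarization concludes. *)

Import Order.TTheory GRing.Theory Num.Theory.
Import numFieldNormedType.Exports.
Local Open Scope classical_set_scope.
Local Open Scope ring_scope.
Local Open Scope complex_scope.

Set Implicit Arguments.
Unset Strict Implicit.
Unset Printing Implicit Defensive.

(** * Abel and Poisson kernels *)

Section lebesgue_line.
Context {R : realType}.
Local Notation mu := (@lebesgue_measure R).

(** Square integrability of the cosine and sine transforms is not known in advance. The Abel factor
    makes Fubini legitimate in the frequency variable, and because it increases to 1, monotone
    convergence removes it inside the extended reals. The AM-GM bound thus comes out first as a
    Bessel inequality, and this inequality is what carries the identity from continuous functions to
    all of L1 and L2.

    Functions are not identified modulo null sets, so an extension T is not known to be linear and
    agrees with the integral formula only almost everywhere. The isometry for T f + w T g is
    therefore proved by approximating f and g separately; linearity is invoked for the integral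
    formula on the approximants.

    Estimates use real squared norms, and |z + w|^2 <= (1 + e)|z|^2 + (1 + 1/e)|w|^2 with arbitrary
    e > 0 stands in for Minkowski's inequality. *)

Lemma ge0_integral_opp (f : R -> \bar R) :
  measurable_fun [set: R] f -> (forall x, 0 <= f x)%E ->
  (\int[mu]_x f (- x)%R = \int[mu]_x f x)%E.
Proof.
move=> mf f0.
have mN : measurable_fun [set: R] (-%R : R -> R) by exact: oppr_measurable.
rewrite -[LHS](@ge0_integral_pushforward _ _ (measurableTypeR R) (measurableTypeR R) R (-%R) mN mu setT f)//.
by apply: eq_measure_integral => //= A mA _; exact: lebesgue_measureN.
Qed.

(** Lebesgue measure and [a] times its pushforward under x -> a x + b give every interval ]c, d] the
    same length, so they coincide by uniqueness. *)
Lemma ge0_integral_affine (a b : R) (f : R -> \bar R) : 0 < a ->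
  measurable_fun [set: R] f -> (forall x, 0 <= f x)%E ->
  (\int[mu]_x f x = a%:E * \int[mu]_x f (a * x + b)%R)%E.
Proof.
move=> a0 mf f0.
pose phi : measurableTypeR R -> measurableTypeR R := fun x => a * x + b.
have mphi : measurable_fun [set: measurableTypeR R] phi.
  apply: (@measurable_funD _ (measurableTypeR R)); last exact: measurable_cst.
  exact: mulrl_measurable.
rewrite -[X in (_ * X)%E](@ge0_integral_pushforward _ _ _ _ _ phi mphi mu setT f)//.
pose na : {nonneg R} := NngNum (ltW a0).
rewrite -[a]/(na%:num).
rewrite -(ge0_integral_mscale (pushforward mu phi) measurableT na)//.
apply: eq_measure_integral => //= A mA _; apply: lebesgue_measure_unique => //= _ [[c d]] _ <-.
rewrite /mscale /= /pushforward.
have -> : phi @^-1` `]c, d]%classic = `](c - b) / a, (d - b) / a]%classic.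
  apply/seteqP; split=> x /=; rewrite !in_itv/= /phi ltr_pdivrMr// ler_pdivlMr//;
    rewrite ltrBlDr lerBrDr mulrC//.
rewrite !lebesgue_measure_itv/= !lte_fin ltr_pM2r ?invr_gt0// ltrD2r.
case: ifPn => _; last by rewrite mule0.
rewrite -!EFinB -EFinM; congr EFin; field; exact: lt0r_neq0.
Qed.

(* Even extension of e^{-es}(1 + cos(ws)), whose antiderivative is explicit *)
Lemma integral_abel_cosD1 (e w : R) : 0 < e ->
  (\int[mu]_s (expR (- (e * `|s|)) * (1 + cos (w * s)))%:E =
   (2 * (e^-1 + e / (e ^+ 2 + w ^+ 2)))%:E)%E.
Proof.
move=> e0.
have cabs : continuous (fun s : R => expR (- (e * `|s|)) * (1 + cos (w * s))).
  move=> s; apply: cvgM.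
    apply: continuous_comp; last exact: continuous_expR.
    apply: cvgN; apply: cvgM; first exact: cvg_cst.
    exact: norm_continuous.
  apply: cvgD; first exact: cvg_cst.
  apply: continuous_comp; last exact: continuous_cos.
  apply: cvgM; [exact: cvg_cst|exact: cvg_id].
(* The summand 1 keeps the integrand nonnegative, as the symmetry lemma and the FTC on a half-line
   both require. *)
have f0 (s : R) : 0 <= expR (- (e * `|s|)) * (1 + cos (w * s)).
  by rewrite mulr_ge0 ?expR_ge0//; have := cos_geN1 (w * s); lra.
rewrite ge0_symfun_integralT//; last by move=> s /=; rewrite normrN mulrN cosN.
rewrite EFinM; congr (_ * _)%E.
have D0 : e ^+ 2 + w ^+ 2 != 0.
  by apply: lt0r_neq0; rewrite ltr_wpDr ?sqr_ge0// exprn_gt0.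
pose F (s : R) := - expR (- (e * s)) * (e^-1 + (e * cos (w * s) - w * sin (w * s)) / (e ^+ 2 + w ^+ 2)).
have dF (s : R) : is_derive s 1 F (expR (- (e * s)) * (1 + cos (w * s))).
  rewrite /F; apply: is_derive_eq.
  rewrite /GRing.scale/=. 
  field.
  by rewrite D0 lt0r_neq0.
rewrite -set_itvcy.
transitivity (\int[mu]_(x in `[0%R, +oo[) (expR (- (e * x)) * (1 + cos (w * x)))%:E)%E.
  by apply: eq_integral => x; rewrite inE/= in_itv/= andbT => x0; rewrite ger0_norm.
rewrite (@ge0_continuous_FTC2y _ _ F 0 0).
- rewrite /F !mulr0 cos0 oppr0 expR0 ?mulr0 ?sin0 -EFinB; congr EFin; ring.
- by move=> x _; rewrite mulr_ge0 ?expR_ge0//; have := cos_geN1 (w * x); lra.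
- apply: continuous_subspaceT => s.
  by apply: differentiable_continuous; exact/derivable1_diffP/ex_derive.
(* [K] bounds the trigonometric factor of [F] uniformly in s, so [F] vanishes at infinity like exp(-
   e s). *)
- pose K := e^-1 + (e + `|w|) / (e ^+ 2 + w ^+ 2).
  have eK : expR (- (e * s)) * K @[s --> +oo] --> (0 : R).
    have e0K : expR (- (e * s)) @[s --> +oo] --> (0 : R).
      apply: (@cvg_comp _ _ _ (fun s => e * s) (fun s => expR (- s)) _ +oo); last exact: cvgr_expR.
      exact: gt0_cvgMry.
    by have := cvgM e0K (@cvg_cst _ K _ +oo _); rewrite mul0r; exact.
  apply: norm_cvg0; apply: (squeeze_cvgr _ (cvg_cst 0) eK).
  near=> s; rewrite normr_ge0/= /F normrM normrN (ger0_norm (expR_ge0 _)) ler_wpM2l ?expR_ge0//.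
  apply: (le_trans (ler_normD _ _)); rewrite (@ger0_norm _ e^-1) ?invr_ge0 ?(ltW e0)// /K lerD2l.
  rewrite normrM (@ger0_norm _ (_^-1)) ?invr_ge0 ?addr_ge0 ?sqr_ge0//.
  rewrite ler_wpM2r ?invr_ge0 ?addr_ge0 ?sqr_ge0//.
  apply: (le_trans (ler_normB _ _)); rewrite !normrM (gtr0_norm e0) lerD//.
    by rewrite ler_piMr ?(ltW e0)// ler_norml cos_geN1 cos_le1.
  by rewrite ler_piMr// ler_norml sin_geN1 sin_le1.
- by move=> x _; exact: ex_derive.
- apply: cvg_at_right_filter.
  apply: differentiable_continuous; exact/derivable1_diffP/ex_derive.
- by move=> x _; rewrite derive1E; exact: derive_val.
Unshelve. all: end_near. Qed.

Lemma integrable_abel (e : R) : 0 < e ->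
  mu.-integrable setT (fun s => (expR (- (e * `|s|)))%:E).
Proof.
move=> e0; apply/integrableP; split.
  apply/measurable_EFinP/measurableT_comp => //.
  by apply/measurableT_comp => //; apply: measurable_funM => //; exact: normr_measurable.
have := integral_abel_cosD1 0 e0.
under eq_integral do rewrite mul0r cos0 EFinM.
rewrite ge0_integralZr//.
- move=> h; under eq_integral do rewrite /= ger0_norm ?expR_ge0//.
  rewrite ltNge leye_eq; apply/negP => /eqP y.
  by move: h; rewrite y gt0_mulye// lte_fin; lra.
- apply/measurable_EFinP/measurableT_comp => //.
  by apply/measurableT_comp => //; apply: measurable_funM => //; exact: normr_measurable.
Qed.

(** The integrand changes sign, so it is reached by subtraction: the formula for 1 + cos minus half
    of its instance at w = 0. *)
Lemma Rintegral_abel_cos (e w : R) : 0 < e ->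
  \int[mu]_s (expR (- (e * `|s|)) * cos (w * s)) = 2 * e / (e ^+ 2 + w ^+ 2).
Proof.
move=> e0.
have me : measurable_fun [set: R] (fun s => expR (- (e * `|s|))).
  apply/measurableT_comp => //.
  by apply/measurableT_comp => //; apply: measurable_funM => //; exact: normr_measurable.
have mc : measurable_fun [set: R] (fun s => cos (w * s)).
  apply: continuous_measurable_fun => s.
  apply: continuous_comp; last exact: continuous_cos.
  by apply: cvgM; [exact: cvg_cst|exact: cvg_id].
have i1 := integrable_abel e0.
have i2 : mu.-integrable setT (fun s => (expR (- (e * `|s|)) * cos (w * s))%:E).
  apply: le_integrable i1 => //; first exact/measurable_EFinP/measurable_funM.
  move=> s _; rewrite lee_fin /= normrM ler_piMr// ler_norml cos_geN1 cos_le1//.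
have E0 : \int[mu]_s expR (- (e * `|s|)) = 2 * e^-1.
  have := integral_abel_cosD1 0 e0.
  under eq_integral do rewrite mul0r cos0 EFinM.
  rewrite integralZr//= -[X in (X * _)%E]fineK ?integrable_fin_num//.
  rewrite -EFinM => -[]; rewrite -/(Rintegral _ _ _) => h.
  apply: (@mulIf _ (1 + 1)); first by rewrite -[1+1]/(2%:R) pnatr_eq0.
  by rewrite h expr0n /= addr0; field; exact: lt0r_neq0.
have := integral_abel_cosD1 w e0.
under eq_integral do rewrite mulrDr mulr1.
move=> /(congr1 fine); rewrite -[LHS]/(Rintegral _ _ _) RintegralD// E0 /= => h.
apply: (@addrI _ (2 * e^-1)); rewrite h; field.
by rewrite !lt0r_neq0// ltr_wpDr ?sqr_ge0// exprn_gt0.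
Qed.

(** The cosine transform of exp(- e |s|) at frequency g x. For g nonzero it is 2 pi / |g| times the
    normalised Poisson kernel of the half-plane at height e / |g|. *)
Definition poisson (g e x : R) : R := 2 * e / (e ^+ 2 + (g * x) ^+ 2).

Lemma poisson_ge0 g e x : 0 < e -> 0 <= poisson g e x.
Proof.
by move=> e0; rewrite /poisson divr_ge0 ?addr_ge0 ?sqr_ge0 ?mulr_ge0 ?ltW.
Qed.

Lemma continuous_poisson g e : 0 < e -> continuous (poisson g e).
Proof.
move=> e0 x; apply: cvgM; first exact: cvg_cst.
apply: cvgV; first by apply: lt0r_neq0; rewrite ltr_wpDr ?sqr_ge0// exprn_gt0.
apply: cvgD; first exact: cvg_cst.
by apply: cvgM; (apply: cvgM; [exact: cvg_cst|exact: cvg_id]).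
Qed.

Lemma poissonB g e x y : poisson g e (x - y) = poisson g e (y - x).
Proof. by rewrite /poisson !exprMn -(sqrrN (y - x)) opprB. Qed.

Lemma integral_oneDsqrV : (\int[mu]_x ((oneDsqr x)^-1)%:E = pi%:E)%E.
Proof.
rewrite ge0_symfun_integralT.
- by rewrite -set_itvcy integral0y_oneDsqr -EFinM; congr EFin; field.
- by move=> x; rewrite invr_ge0 addr_ge0 ?sqr_ge0.
- exact: continuous_oneDsqrV.
- by move=> x/=; rewrite /oneDsqr sqrrN.
Qed.

Lemma integral_poisson g e x : g != 0 -> 0 < e ->
  (\int[mu]_y (poisson g e (x - y))%:E = (2 * pi / `|g|)%:E)%E.
Proof.
move=> g0 e0.
have ng0 : 0 < `|g| by rewrite normr_gt0.
pose a := `|g| / e.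
have a0 : 0 < a by rewrite divr_gt0.
have mo : measurable_fun [set: R] (fun y : R => ((oneDsqr y)^-1)%:E).
  by apply/measurable_EFinP; apply: continuous_measurable_fun; exact: (@continuous_oneDsqrV R).
have o0 (y : R) : 0 <= (oneDsqr y)^-1.
  by rewrite invr_ge0 addr_ge0 ?sqr_ge0.
have Eo := ge0_integral_affine (- a * x) a0 mo (fun y => o0 y).
rewrite integral_oneDsqrV in Eo.
transitivity (\int[mu]_y ((2 / e)%:E * ((oneDsqr (a * y + - a * x))^-1)%:E))%E.
  apply: eq_integral => y _; rewrite -EFinM; congr EFin.
  rewrite /poisson /oneDsqr /a exprMn -(real_normK (num_real g)).
  field.
  by rewrite lt0r_neq0//= lt0r_neq0// ltr_wpDr ?sqr_ge0// exprn_gt0.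
rewrite ge0_integralZl//=.
- set I := (X in (_ * X)%E); rewrite -/I in Eo.
(* [Eo] reads pi = a I in the extended reals; since a > 0, an infinite [I] would make the right side
   infinite. *)
have -> : I = (pi / a)%:E.
  move: Eo; rewrite /I; case: (\int[mu]_y _)%E => [r| |] //=.
  - by rewrite -EFinM => -[->]; congr EFin; field; exact: lt0r_neq0.
  - by rewrite gt0_muley.
  - by rewrite gt0_muleNy.
  rewrite -EFinM /a; congr EFin; field.
  by rewrite !lt0r_neq0.
- apply/measurable_EFinP; apply: (@measurableT_comp _ _ _ _ _ _ (fun z : R => (oneDsqr z)^-1) _ (fun y : R => a * y + - a * x)).
    by apply: continuous_measurable_fun; exact: (@continuous_oneDsqrV R).
  by apply: measurable_funD => //; exact: mulrl_measurable.
- by rewrite lee_fin divr_ge0// ltW.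
Qed.

Lemma integrable_affine (a b : R) (f : R -> \bar R) : 0 < a ->
  mu.-integrable setT f -> mu.-integrable setT (fun x => f (a * x + b)).
Proof.
move=> a0 /integrableP[mf fy]; apply/integrableP; split.
  apply: measurableT_comp => //.
  apply: measurable_funD => //; exact: mulrl_measurable.
have maf : measurable_fun [set: R] (abse \o f) by exact: measurableT_comp.
have /= h := @ge0_integral_affine a b _ a0 maf (fun x => abse_ge0 _).
rewrite ltNge leye_eq; apply/negP => /eqP y.
by move: fy; rewrite h y gt0_muley.
Qed.

Lemma integral_affine (a b : R) (f : R -> \bar R) : 0 < a ->
  mu.-integrable setT f ->
  (\int[mu]_x f x = a%:E * \int[mu]_x f (a * x + b)%R)%E.
Proof.
move=> a0 fi; have fi' := integrable_affine b a0 fi.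
rewrite integralE [in RHS]integralE muleBr//.
  have mf := measurable_int _ fi.
  rewrite (@ge0_integral_affine a b (f^\+)%E)//; last exact: measurable_funepos.
  rewrite (@ge0_integral_affine a b (f^\-)%E)//; last exact: measurable_funeneg.
  by congr (_ * _ - _ * _)%E; apply: eq_integral => y _; rewrite ?funeposE ?funenegE.
by rewrite fin_num_adde_defr//; exact: integrable_pos_fin_num.
Qed.

Lemma Rintegral_affine (a b : R) (f : R -> R) : 0 < a ->
  mu.-integrable setT (EFin \o f) ->
  \int[mu]_x f x = a * \int[mu]_x f (a * x + b).
Proof.
move=> a0 fi; rewrite /Rintegral (integral_affine b a0 fi) fineM//.
exact: (integrable_fin_num _ (integrable_affine b a0 fi)).
Qed.

End lebesgue_line.

(** * Real-valued integrals: domination, continuity in a parameter, Fubini *)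

Section lebesgue_tools.
Context {R : realType}.
Local Notation mu := (@lebesgue_measure R).

Lemma integrableZl_EFin (k : R) (f : R -> R) : mu.-integrable setT (EFin \o f) ->
  mu.-integrable setT (EFin \o (fun x => k * f x)).
Proof. by move=> fi; exact: (integrableZl measurableT k fi). Qed.

Lemma integrableZr_EFin (k : R) (f : R -> R) : mu.-integrable setT (EFin \o f) ->
  mu.-integrable setT (EFin \o (fun x => f x * k)).
Proof. by move=> fi; exact: (integrableZr measurableT k fi). Qed.

Lemma integrableD_EFin (f g : R -> R) : mu.-integrable setT (EFin \o f) ->
  mu.-integrable setT (EFin \o g) -> mu.-integrable setT (EFin \o (fun x => f x + g x)).
Proof. by move=> fi gi; exact: (integrableD measurableT fi gi). Qed.

Lemma integrableB_EFin (u v : R -> R) : mu.-integrable setT (EFin \o u) ->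
  mu.-integrable setT (EFin \o v) -> mu.-integrable setT (EFin \o (fun x => u x - v x)).
Proof.
move=> ui vi; have := integrableD_EFin ui (integrableZl_EFin (-1) vi).
by under eq_fun do rewrite mulN1r.
Qed.

Lemma le_integrable_EFin (f g : R -> R) : measurable_fun [set: R] f ->
  (forall x, `|f x| <= g x) -> mu.-integrable setT (EFin \o g) ->
  mu.-integrable setT (EFin \o f).
Proof.
move=> mf fg gi; apply: le_integrable gi => //; first exact/measurable_EFinP.
by move=> x _; rewrite !abse_EFin lee_fin (le_trans (fg x))// ler_norm.
Qed.

Lemma EFin_Rintegral (f : R -> R) : mu.-integrable setT (EFin \o f) ->
  (\int[mu]_x f x)%:E = (\int[mu]_x (f x)%:E)%E.
Proof. by move=> fi; rewrite /Rintegral fineK//; exact: (integrable_fin_num _ fi). Qed.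

Lemma dominated_Rintegral_cvg (f_ : nat -> R -> R) (f g : R -> R) :
  (forall n, measurable_fun [set: R] (f_ n)) -> measurable_fun [set: R] f ->
  (forall x, f_ n x @[n --> \oo] --> f x) ->
  mu.-integrable setT (EFin \o g) -> (forall n x, `|f_ n x| <= g x) ->
  \int[mu]_x f_ n x @[n --> \oo] --> \int[mu]_x f x.
Proof.
move=> mf_ mf ff gi fg.
have fi n : mu.-integrable setT (EFin \o f_ n) by exact: le_integrable_EFin gi.
have mEf_ n : measurable_fun [set: R] (EFin \o f_ n) by exact/measurable_EFinP.
have mEf : measurable_fun [set: R] (EFin \o f) by exact/measurable_EFinP.
have [||_ _] := @dominated_convergence _ _ _ mu setT measurableT _ (EFin \o f) (EFin \o g) mEf_ mEf _ gi _.
- by apply: aeW => x _; apply: cvg_EFin; [exact: nearW|exact: ff].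
- by apply: aeW => x n _; rewrite lee_fin fg.
move=> h.
apply: fine_cvg; rewrite EFin_Rintegral//.
(* The pointwise limit inherits the bound [g], so its integral is finite and [fine] loses
   nothing. *)
apply: (@le_integrable_EFin _ g) => // x.
rewrite -(cvg_lim _ (cvg_norm (ff x)))//.
by apply: limr_le; [apply: (is_cvg_norm _); apply: cvgP (ff x)|exact: nearW].
Qed.

Lemma continuous_Rintegral_kernel (k : R -> R -> R) (u : R -> R) (M : R) :
  (forall t, continuous (k ^~ t)) -> (forall s, measurable_fun [set: R] (k s)) ->
  (forall s t, `|k s t| <= M) -> mu.-integrable setT (EFin \o u) ->
  continuous (fun s => \int[mu]_t (k s t * u t)).
Proof.
move=> ck mk kM ui s.
have mu_ : measurable_fun [set: R] u by apply/measurable_EFinP; exact: measurable_int ui.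
have gi : mu.-integrable setT (EFin \o (fun t => M * `|u t|)).
  by apply: integrableZl_EFin; exact: integrable_norm.
have kg x t : `|k x t * u t| <= M * `|u t| by rewrite normrM ler_wpM2r.
apply: (@continuity_under_integral _ _ _ mu (fun s t => k s t * u t) setT measurableT
   (s - 1) (s + 1) _ _ (fun t => M * `|u t|)).
- move=> x _; apply: le_integrable_EFin gi => //; exact: measurable_funM.
- apply: aeW => t _ x _; apply: cvgM; [exact: ck|exact: cvg_cst].
- exact: gi.
- by move=> x _; apply: aeW => t _; exact: kg.
- by rewrite inE/= in_itv/= ltrBlDr !ltrDl ltr01.
Qed.

(** The product bound with integrable factors makes [F] integrable on the plane by Tonelli, after
    which Fubini applies. *)
Lemma Rintegral_Fubini_dominated (F : R * R -> R) (g h : R -> R) :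
  measurable_fun setT F ->
  mu.-integrable setT (EFin \o g) -> mu.-integrable setT (EFin \o h) ->
  (forall x, 0 <= g x) ->
  (forall x y, `|F (x, y)| <= g x * h y) ->
  \int[mu]_x \int[mu]_y F (x, y) = \int[mu]_y \int[mu]_x F (x, y).
Proof.
move=> mF gi hi g0 Fgh.
have mFx x : measurable_fun [set: R] (fun y => F (x, y)) by exact: measurableT_comp.
have mFy y : measurable_fun [set: R] (fun x => F (x, y)) by exact: measurableT_comp.
have ix x : mu.-integrable setT (EFin \o (fun y => F (x, y))).
  apply: (@le_integrable_EFin _ (fun y => g x * h y)) => //.
  exact: integrableZl_EFin.
have iy y : mu.-integrable setT (EFin \o (fun x => F (x, y))).
  apply: (@le_integrable_EFin _ (fun x => g x * h y)) => //.
  exact: integrableZr_EFin.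
have Fi : (mu \x mu)%E.-integrable setT (EFin \o F).
  apply/integrable12ltyP; first exact/measurable_EFinP.
  apply: (@le_lt_trans _ _ (\int[mu]_x ((g x)%:E * \int[mu]_y (h y)%:E))%E).
    apply: ge0_le_integral => //=.
    - by move=> x _; exact: integral_ge0.
    - apply: (@measurable_fun_fubini_tonelli_F _ _ _ _ _ mu (fun z : R * R => `|(F z)%:E|%E)) => //=.
      by apply/measurable_EFinP; apply: measurableT_comp.
    - apply: emeasurable_funM => //; first exact: measurable_int gi.
    - move=> x _; rewrite -integralZl//; apply: ge0_le_integral => //=.
      + by apply/measurable_EFinP; exact: (measurableT_comp (@normr_measurable _ _) (mFx x)).
      + by apply: emeasurable_funM => //; exact: measurable_int hi.
      + by move=> y _; rewrite -EFinM lee_fin.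
  by rewrite -(EFin_Rintegral hi) integralZr// -(EFin_Rintegral gi) -EFinM ltry.
rewrite {1 3}/Rintegral.
transitivity (fine (\int[mu]_x \int[mu]_y (F (x, y))%:E)%E).
  by congr fine; apply: eq_integral => x _; rewrite EFin_Rintegral.
rewrite (Fubini Fi)//.
by congr fine; apply: eq_integral => y _; rewrite EFin_Rintegral.
Qed.

End lebesgue_tools.

(** * Cosine and sine transforms *)

Section cosine_sine_transforms.
Context {R : realType}.
Local Notation mu := (@lebesgue_measure R).
Local Notation intg f := (mu.-integrable setT (EFin \o f)).
Variable g : R.
Hypothesis g0 : g != 0.

Definition cosT (u : R -> R) (s : R) : R := \int[mu]_t (cos (s * t * g) * u t).
Definition sinT (u : R -> R) (s : R) : R := \int[mu]_t (sin (s * t * g) * u t).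

Lemma norm_cos_le1 (x : R) : `|cos x| <= 1.
Proof. by rewrite ler_norml cos_geN1 cos_le1. Qed.

Lemma norm_sin_le1 (x : R) : `|sin x| <= 1.
Proof. by rewrite ler_norml sin_geN1 sin_le1. Qed.

Lemma measurable_cos_phase (s : R) : measurable_fun [set: R] (fun t => cos (s * t * g)).
Proof.
apply: continuous_measurable_fun => t; apply: continuous_comp; last exact: continuous_cos.
by apply: cvgM; [apply: cvgM; [exact: cvg_cst|exact: cvg_id]|exact: cvg_cst].
Qed.

Lemma measurable_sin_phase (s : R) : measurable_fun [set: R] (fun t => sin (s * t * g)).
Proof.
apply: continuous_measurable_fun => t; apply: continuous_comp; last exact: continuous_sin.
by apply: cvgM; [apply: cvgM; [exact: cvg_cst|exact: cvg_id]|exact: cvg_cst].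
Qed.

Lemma continuous_cosT u : intg u -> continuous (cosT u).
Proof.
move=> ui; apply: (@continuous_Rintegral_kernel _ (fun s t => cos (s * t * g)) u 1) => //.
- move=> t s; apply: continuous_comp; last exact: continuous_cos.
  by apply: cvgM; [apply: cvgM; [exact: cvg_id|exact: cvg_cst]|exact: cvg_cst].
- exact: measurable_cos_phase.
- by move=> s t; exact: norm_cos_le1.
Qed.

Lemma continuous_sinT u : intg u -> continuous (sinT u).
Proof.
move=> ui; apply: (@continuous_Rintegral_kernel _ (fun s t => sin (s * t * g)) u 1) => //.
- move=> t s; apply: continuous_comp; last exact: continuous_sin.
  by apply: cvgM; [apply: cvgM; [exact: cvg_id|exact: cvg_cst]|exact: cvg_cst].
- exact: measurable_sin_phase.
- by move=> s t; exact: norm_sin_le1.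
Qed.

Lemma integrable_bounded_mul (k u : R -> R) (M : R) : measurable_fun [set: R] k ->
  (forall t, `|k t| <= M) -> intg u -> intg (fun t => k t * u t).
Proof.
move=> mk kM ui; apply: (@le_integrable_EFin _ _ (fun t => M * `|u t|)).
- by apply: measurable_funM => //; apply/measurable_EFinP; exact: measurable_int ui.
- by move=> t; rewrite normrM ler_wpM2r.
- by apply: integrableZl_EFin; exact: integrable_norm.
Qed.

Lemma integrable_cos_mul u s : intg u -> intg (fun t => cos (s * t * g) * u t).
Proof.
by move=> ui; apply: (@integrable_bounded_mul _ _ 1) => // [|t];
  [exact: measurable_cos_phase|exact: norm_cos_le1].
Qed.

Lemma integrable_sin_mul u s : intg u -> intg (fun t => sin (s * t * g) * u t).
Proof.
by move=> ui; apply: (@integrable_bounded_mul _ _ 1) => // [|t];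
  [exact: measurable_sin_phase|exact: norm_sin_le1].
Qed.

Lemma norm_Rintegral_bounded_mul (k u : R -> R) (M : R) : measurable_fun [set: R] k ->
  (forall t, `|k t| <= M) -> intg u ->
  `|\int[mu]_t (k t * u t)| <= M * \int[mu]_t `|u t|.
Proof.
move=> mk kM ui; have iku := integrable_bounded_mul mk kM ui.
apply: (le_trans (le_normr_Rintegral measurableT iku)).
rewrite -RintegralZl//; last exact: integrable_norm.
apply: le_Rintegral => //.
- exact: integrable_norm.
- by apply: integrableZl_EFin; exact: integrable_norm.
- by move=> t _; rewrite normrM ler_wpM2r.
Qed.

Lemma norm_cosT_le u s : intg u -> `|cosT u s| <= \int[mu]_t `|u t|.
Proof.
move=> ui; rewrite -[leRHS]mul1r.
by apply: norm_Rintegral_bounded_mul => // [|t]; [exact: measurable_cos_phase|exact: norm_cos_le1].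
Qed.

Lemma norm_sinT_le u s : intg u -> `|sinT u s| <= \int[mu]_t `|u t|.
Proof.
move=> ui; rewrite -[leRHS]mul1r.
by apply: norm_Rintegral_bounded_mul => // [|t]; [exact: measurable_sin_phase|exact: norm_sin_le1].
Qed.

Definition poissonT (e : R) (u : R -> R) (x : R) : R :=
  \int[mu]_y (poisson g e (x - y) * u y).

Lemma poisson_le e x : 0 < e -> `|poisson g e x| <= 2 / e.
Proof.
move=> e0; rewrite ger0_norm ?poisson_ge0//.
rewrite /poisson ler_pdivrMr ?ltr_wpDr ?sqr_ge0 ?exprn_gt0//.
rewrite -subr_ge0.
have -> : 2 / e * (e ^+ 2 + (g * x) ^+ 2) - 2 * e = 2 / e * (g * x) ^+ 2.
  by field; exact: lt0r_neq0.
by rewrite mulr_ge0 ?sqr_ge0// divr_ge0// ltW.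
Qed.

Lemma measurable_poissonB e x : 0 < e -> measurable_fun [set: R] (fun y => poisson g e (x - y)).
Proof.
move=> e0; apply: (measurableT_comp (continuous_measurable_fun (@continuous_poisson _ g e e0))).
exact: measurable_funB.
Qed.

Lemma continuous_poissonT e u : 0 < e -> intg u -> continuous (poissonT e u).
Proof.
move=> e0 ui.
apply: (@continuous_Rintegral_kernel _ (fun x y => poisson g e (x - y)) u (2 / e)) => //.
- move=> y x; apply: (@continuous_comp _ _ _ (fun x => x - y)); last exact: continuous_poisson.
  by apply: cvgB; [exact: cvg_id|exact: cvg_cst].
- by move=> x; exact: measurable_poissonB.
- by move=> x y; exact: poisson_le.
Qed.

Lemma measurable_comp_fst (c : R -> R) : measurable_fun [set: R] c ->
  measurable_fun setT (fun z : R * R => c z.1).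
Proof. by move=> mc; exact: (measurableT_comp mc measurable_fst). Qed.

Lemma measurable_comp_snd (c : R -> R) : measurable_fun [set: R] c ->
  measurable_fun setT (fun z : R * R => c z.2).
Proof. by move=> mc; exact: (measurableT_comp mc measurable_snd). Qed.

Lemma measurable_phase2 (c : R -> R) : measurable_fun [set: R] c ->
  measurable_fun setT (fun z : R * R => c (z.1 * z.2 * g)).
Proof.
move=> mc; apply: (@measurableT_comp _ _ _ _ _ _ c _ (fun z : R * R => z.1 * z.2 * g)) => //.
by apply: measurable_funM => //; exact: measurable_funM.
Qed.

(* cos(s(x-y)) = cos(sx)cos(sy) + sin(sx)sin(sy), then Fubini in y and in x *)
Lemma abel_cosT_sinT e u : 0 < e -> intg u ->
  \int[mu]_s (expR (- (e * `|s|)) * (cosT u s ^+ 2 + sinT u s ^+ 2)) =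
  \int[mu]_x (u x * poissonT e u x).
Proof.
move=> e0 ui.
have mu_ : measurable_fun [set: R] u by apply/measurable_EFinP; exact: measurable_int ui.
have mC : measurable_fun [set: R] (cosT u) by apply: continuous_measurable_fun; exact: continuous_cosT.
have mS : measurable_fun [set: R] (sinT u) by apply: continuous_measurable_fun; exact: continuous_sinT.
have mcos : measurable_fun [set: R] (@cos R) by apply: continuous_measurable_fun; exact: continuous_cos.
have msin : measurable_fun [set: R] (@sin R) by apply: continuous_measurable_fun; exact: continuous_sin.
have me : measurable_fun [set: R] (fun s : R => expR (- (e * `|s|))).
  by apply/measurable_EFinP; exact: measurable_int (integrable_abel e0).
pose D s x := cos (s * x * g) * cosT u s + sin (s * x * g) * sinT u s.
set M := \int[mu]_t `|u t|.
have DM s x : `|D s x| <= 2 * M.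
  rewrite (le_trans (ler_normD _ _))// !normrM mulr_natl mulr2n lerD//.
    by rewrite -[leRHS]mul1r ler_pM ?norm_cos_le1// norm_cosT_le.
  by rewrite -[leRHS]mul1r ler_pM ?norm_sin_le1// norm_sinT_le.
have iD s : intg (fun x => u x * D s x).
  under eq_fun do rewrite mulrC; apply: (@integrable_bounded_mul _ _ (2 * M)) => //.
  by apply: measurable_funD; apply: measurable_funM => //; [exact: measurable_cos_phase|exact: measurable_sin_phase].
transitivity (\int[mu]_s \int[mu]_x (expR (- (e * `|s|)) * (u x * D s x))).
  apply: eq_Rintegral => s _; rewrite RintegralZl//; congr (_ * _).
  rewrite !expr2 {1}/cosT {1}/sinT -RintegralZr//; last exact: integrable_cos_mul.
  rewrite -RintegralZr//; last exact: integrable_sin_mul.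
  rewrite -RintegralD//; last 2 first.
  - by apply: integrableZr_EFin; exact: integrable_cos_mul.
  - by apply: integrableZr_EFin; exact: integrable_sin_mul.
  by apply: eq_Rintegral => x _; rewrite /D; ring.
(* The damping factor supplies the integrability in s, since [D] is merely bounded by 2 M; [u]
   supplies it in x. *)
rewrite (@Rintegral_Fubini_dominated _ (fun z => expR (- (e * `|z.1|)) * (u z.2 * D z.1 z.2))
  (fun s => expR (- (e * `|s|)) * (2 * M)) (fun x => `|u x|)); last 5 first.
- apply: measurable_funM; first exact: (measurable_comp_fst me).
  apply: measurable_funM; first exact: (measurable_comp_snd mu_).
  apply: measurable_funD; apply: measurable_funM.
  + exact: measurable_phase2.
  + exact: (measurable_comp_fst mC).
  + exact: measurable_phase2.
  + exact: (measurable_comp_fst mS).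
- by apply: integrableZr_EFin; exact: integrable_abel.
- exact: integrable_norm.
- by move=> s; rewrite mulr_ge0 ?expR_ge0// (le_trans _ (DM 0 0)).
- move=> s x /=; rewrite normrM (ger0_norm (expR_ge0 _)) -mulrA ler_wpM2l ?expR_ge0//.
  by rewrite normrM mulrC ler_wpM2r.
apply: eq_Rintegral => x _ /=.
have iDx : intg (fun s => expR (- (e * `|s|)) * D s x).
  under eq_fun do rewrite mulrC; apply: (@integrable_bounded_mul _ _ (2 * M)) => //.
    apply: measurable_funD; apply: measurable_funM => //.
      by under eq_fun do rewrite mulrAC -mulrA; apply: (measurableT_comp mcos); exact: mulrr_measurable.
    by under eq_fun do rewrite mulrAC -mulrA; apply: (measurableT_comp msin); exact: mulrr_measurable.
  exact: integrable_abel.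
transitivity (u x * \int[mu]_s (expR (- (e * `|s|)) * D s x)).
  by rewrite -RintegralZl//; apply: eq_Rintegral => s _; rewrite mulrCA.
congr (_ * _).
transitivity (\int[mu]_s \int[mu]_y (expR (- (e * `|s|)) * (cos (s * (x - y) * g) * u y))).
  apply: eq_Rintegral => s _; rewrite RintegralZl//; last first.
    apply: (@integrable_bounded_mul _ _ 1) => // [|t]; last exact: norm_cos_le1.
    apply: (measurableT_comp mcos); apply: measurable_funM => //.
    by apply: measurable_funM => //; exact: measurable_funB.
  congr (_ * _); rewrite /D {1}/cosT {1}/sinT -!RintegralZl//; last 2 first.
  - exact: integrable_sin_mul.
  - exact: integrable_cos_mul.
  rewrite -RintegralD//; last 2 first.
  - by apply: integrableZl_EFin; exact: integrable_cos_mul.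
  - by apply: integrableZl_EFin; exact: integrable_sin_mul.
  by apply: eq_Rintegral => y _; rewrite mulrBr mulrBl cosB; ring.
rewrite (@Rintegral_Fubini_dominated _ (fun z => expR (- (e * `|z.1|)) * (cos (z.1 * (x - z.2) * g) * u z.2))
  (fun s => expR (- (e * `|s|))) (fun x => `|u x|)); last 5 first.
- apply: measurable_funM; first exact: (measurable_comp_fst me).
  apply: measurable_funM; last exact: (measurable_comp_snd mu_).
  apply: (@measurableT_comp _ _ _ _ _ _ (@cos R) _ (fun z : R * R => z.1 * (x - z.2) * g)) => //.
  apply: measurable_funM => //; apply: measurable_funM => //; exact: measurable_funB.
- exact: integrable_abel.
- exact: integrable_norm.
- by move=> s; rewrite expR_ge0.
- move=> s y /=; rewrite normrM (ger0_norm (expR_ge0 _)) ler_wpM2l ?expR_ge0//.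
  by rewrite normrM ler_piMl// norm_cos_le1.
apply: eq_Rintegral => y _ /=.
under eq_Rintegral do rewrite mulrA.
rewrite RintegralZr//; last first.
  under eq_fun do rewrite mulrC; apply: (@integrable_bounded_mul _ _ 1); last exact: integrable_abel.
    apply: (measurableT_comp mcos); apply: measurable_funM => //; exact: mulrr_measurable.
  by move=> s; exact: norm_cos_le1.
congr (_ * _).
rewrite /poisson -Rintegral_abel_cos//; apply: eq_Rintegral => s _.
by congr (_ * cos _); ring.
Qed.

End cosine_sine_transforms.

(** * Removal of the Abel factor: Bessel inequality and Plancherel for continuous functions *)

Section abel_limit.
Context {R : realType}.
Local Notation mu := (@lebesgue_measure R).
Local Notation intg f := (mu.-integrable setT (EFin \o f)).
Variable g : R.
Hypothesis g0 : g != 0.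
Let kappa : R := 2 * pi / `|g|.
Let ng0 : 0 < `|g|. Proof. by rewrite normr_gt0. Qed.

Lemma integrable_poissonB e x : 0 < e -> intg (fun y => poisson g e (x - y)).
Proof.
move=> e0; apply/integrableP; split.
  by apply/measurable_EFinP; exact: measurable_poissonB.
under eq_integral do rewrite /= ger0_norm ?poisson_ge0//.
by rewrite integral_poisson// ltry.
Qed.

(** Tonelli applies because everything is nonnegative, and by the symmetry of the kernel in x and y
    the integral over x again has mass [kappa]. *)
Lemma poissonT_mass e (w : R -> R) : 0 < e -> (forall x, 0 <= w x) -> intg w ->
  intg (poissonT g e w) /\ \int[mu]_x poissonT g e w x = kappa * \int[mu]_x w x.
Proof.
move=> e0 w0 wi.
have mw : measurable_fun [set: R] w by apply/measurable_EFinP; exact: measurable_int wi.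
have ik x : intg (fun y => poisson g e (x - y) * w y).
  apply: (@integrable_bounded_mul _ _ _ (2 / e)) => //; first exact: measurable_poissonB.
  by move=> y; exact: poisson_le.
have mP : measurable_fun [set: R] (poissonT g e w).
  by apply: continuous_measurable_fun; exact: continuous_poissonT.
have P0 x : 0 <= poissonT g e w x.
  by apply: Rintegral_ge0 => y _; rewrite mulr_ge0 ?poisson_ge0.
have E : (\int[mu]_x (poissonT g e w x)%:E = (kappa * \int[mu]_x w x)%:E)%E.
  transitivity (\int[mu]_x \int[mu]_y (poisson g e (x - y) * w y)%:E)%E.
    by apply: eq_integral => x _; rewrite EFin_Rintegral.
  transitivity (\int[mu]_y \int[mu]_x (poisson g e (x - y) * w y)%:E)%E.
    apply: (@fubini_tonelli _ _ _ _ _ mu mu (fun z : R * R => (poisson g e (z.1 - z.2) * w z.2)%:E)).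
      apply/measurable_EFinP; apply: measurable_funM; last exact: measurable_comp_snd.
      apply: (@measurableT_comp _ _ _ _ _ _ (poisson g e) _ (fun z : R * R => z.1 - z.2)).
        by apply: continuous_measurable_fun; exact: continuous_poisson.
      exact: measurable_funB.
    by move=> z; rewrite lee_fin mulr_ge0 ?poisson_ge0.
  transitivity (\int[mu]_y (kappa%:E * (w y)%:E))%E.
    apply: eq_integral => y _; rewrite -(integral_poisson y g0 e0).
    rewrite -ge0_integralZr//.
    - by apply: eq_integral => x _; rewrite EFinM poissonB.
    - by apply/measurable_EFinP; exact: measurable_poissonB.
    - by move=> x _; rewrite lee_fin poisson_ge0.
    - by rewrite lee_fin.
  by rewrite (EFinM kappa) EFin_Rintegral// integralZl.
have iP : intg (poissonT g e w).
  apply/integrableP; split; first exact/measurable_EFinP.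
  by under eq_integral do rewrite /= ger0_norm//; rewrite E ltry.
by split=> //; apply: EFin_inj; rewrite EFin_Rintegral.
Qed.

Lemma integrable_mul_poissonT e u : 0 < e -> intg u -> intg (fun x => u x * poissonT g e u x).
Proof.
move=> e0 ui; under eq_fun do rewrite mulrC.
apply: (@integrable_bounded_mul _ _ _ (2 / e * \int[mu]_t `|u t|)) => //.
  by apply: continuous_measurable_fun; exact: continuous_poissonT.
move=> x; apply: norm_Rintegral_bounded_mul => //; first exact: measurable_poissonB.
by move=> y; exact: poisson_le.
Qed.

(** This is Schur's test for a symmetric kernel. After u(x) u(y) <= (u(x)^2 + u(y)^2) / 2, the first
    square is integrated through the mass of the kernel in y and the second through [poissonT_mass];
    each gives half of the bound, which does not depend on [e]. *)
Lemma poissonT_form_le e u : 0 < e -> intg u -> intg (fun x => u x ^+ 2) ->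
  \int[mu]_x (u x * poissonT g e u x) <= kappa * \int[mu]_x (u x ^+ 2).
Proof.
move=> e0 ui u2i.
have [iP EP] := poissonT_mass e0 (fun x => sqr_ge0 (u x)) u2i.
have ik (w : R -> R) x : intg w -> intg (fun y => poisson g e (x - y) * w y).
  move=> wi; apply: (@integrable_bounded_mul _ _ _ (2 / e)) => //; first exact: measurable_poissonB.
  by move=> y; exact: poisson_le.
have kE x : \int[mu]_y poisson g e (x - y) = kappa.
  by apply: EFin_inj; rewrite EFin_Rintegral ?integral_poisson//; exact: integrable_poissonB.
apply: (@le_trans _ _ (\int[mu]_x (2^-1 * (kappa * u x ^+ 2 + poissonT g e (fun x => u x ^+ 2) x)))).
  apply: le_Rintegral => //.
  - exact: integrable_mul_poissonT.
  - apply: integrableZl_EFin; apply: integrableD_EFin => //.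
    exact: integrableZl_EFin.
  move=> x _; rewrite -RintegralZl//; last exact: ik.
  rewrite -[X in 2^-1 * (X * _ + _)](kE x) -RintegralZr//; last exact: integrable_poissonB.
  rewrite -RintegralD//; last 2 first.
  - by apply: integrableZr_EFin; exact: integrable_poissonB.
  - exact: ik.
  rewrite -RintegralZl//; last first.
    apply: integrableD_EFin => //; last exact: ik.
    by apply: integrableZr_EFin; exact: integrable_poissonB.
  apply: le_Rintegral => //.
  - by apply: integrableZl_EFin; exact: ik.
  - apply: integrableZl_EFin; apply: integrableD_EFin => //; last exact: ik.
    by apply: integrableZr_EFin; exact: integrable_poissonB.
  move=> y _; rewrite -mulrDr mulrCA [leRHS]mulrCA ler_wpM2l ?poisson_ge0//.
  by have := sqr_ge0 (u x - u y); nra.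
rewrite RintegralZl//; last first.
  by apply: integrableD_EFin => //; exact: integrableZl_EFin.
rewrite RintegralD//; last exact: (integrableZl_EFin _ u2i).
rewrite RintegralZl// EP; lra.
Qed.

(** The factors exp(- |s| / (n + 1)) increase to 1, so monotone convergence identifies the limit in
    the extended reals before its finiteness is known. *)
Lemma cvg_poissonT_form u :
  intg u ->
  (\int[mu]_x (u x * poissonT g (n.+1%:R^-1) u x))%:E @[n --> \oo] -->
  (\int[mu]_s (cosT g u s ^+ 2 + sinT g u s ^+ 2)%:E)%E.
Proof.
move=> ui.
pose Q s := cosT g u s ^+ 2 + sinT g u s ^+ 2.
have mC : measurable_fun [set: R] (cosT g u) by apply: continuous_measurable_fun; exact: continuous_cosT.
have mS : measurable_fun [set: R] (sinT g u) by apply: continuous_measurable_fun; exact: continuous_sinT.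
have mQ : measurable_fun [set: R] Q by apply: measurable_funD; exact: measurable_funX.
have Q0 s : 0 <= Q s by rewrite addr_ge0 ?sqr_ge0.
have e0 n : 0 < n.+1%:R^-1 :> R by rewrite invr_gt0.
have me n : measurable_fun [set: R] (fun s : R => expR (- (n.+1%:R^-1 * `|s|))).
  by apply/measurable_EFinP; exact: measurable_int (integrable_abel (e0 n)).
have iQ n : intg (fun s => expR (- (n.+1%:R^-1 * `|s|)) * Q s).
  under eq_fun do rewrite mulrC.
  set M := \int[mu]_t `|u t|.
  apply: (@integrable_bounded_mul _ _ _ (M ^+ 2 + M ^+ 2)) => //; last exact: integrable_abel.
  move=> s; rewrite ger0_norm// lerD// -[leLHS]real_normK ?num_real// lerXn2r ?nnegrE//.
  - by rewrite Rintegral_ge0.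
  - exact: norm_cosT_le.
  - by rewrite Rintegral_ge0.
  - exact: norm_sinT_le.
have -> : (fun n => (\int[mu]_x (u x * poissonT g (n.+1%:R^-1) u x))%:E) =
    (fun n => \int[mu]_s (expR (- (n.+1%:R^-1 * `|s|)) * Q s)%:E)%E.
  by apply/funext => n; rewrite -abel_cosT_sinT// EFin_Rintegral.
have -> : (\int[mu]_s (Q s)%:E = \int[mu]_s limn (fun n => (expR (- (n.+1%:R^-1 * `|s|)) * Q s)%:E))%E.
  apply: eq_integral => s _; apply/esym/cvg_lim => //; apply: cvg_EFin; first exact: nearW.
  rewrite -[X in _ --> X](mul1r (Q s)); apply: cvgM; last exact: cvg_cst.
  have h : - (n.+1%:R^-1 * `|s|) @[n --> \oo] --> (0 : R).
    rewrite -oppr0 -[X in - X](mul0r `|s|); apply: cvgN; apply: cvgM; last exact: cvg_cst.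
    exact: cvg_harmonic.
  by rewrite -[X in _ --> X]expR0; apply: continuous_cvg => //; exact: continuous_expR.
apply: cvg_monotone_convergence => //.
- by move=> n; apply/measurable_EFinP; exact: (measurable_funM (me n) mQ).
- by move=> n s _; rewrite lee_fin mulr_ge0 ?expR_ge0.
- move=> s _ m n mn; rewrite lee_fin ler_wpM2r// ler_expR lerN2 ler_wpM2r//.
  by rewrite lef_pV2 ?posrE// ler_nat.
Qed.

(** The bound on the Poisson form is uniform in n and survives the limit. Applied to differences, it
    later gives the L2 continuity on which the density argument rests. *)
Lemma bessel_cosT_sinT u : intg u -> intg (fun x => u x ^+ 2) ->
  (\int[mu]_s (cosT g u s ^+ 2 + sinT g u s ^+ 2)%:E <=
   (kappa * \int[mu]_x (u x ^+ 2))%:E)%E.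
Proof.
move=> ui u2i; rewrite -(cvg_lim _ (cvg_poissonT_form ui))//.
apply: lime_le; first by apply/cvg_ex; eexists; exact: cvg_poissonT_form.
by apply: nearW => n; rewrite lee_fin; apply: poissonT_form_le => //; rewrite invr_gt0.
Qed.

(** The substitution y = x + (e / |g|) t moves all dependence on [e] into the argument of [v] and
    leaves a fixed integrable kernel, ready for dominated convergence as e -> 0. *)
Lemma poissonT_dilation e v x : 0 < e -> intg v ->
  poissonT g e v x = \int[mu]_t (v (e / `|g| * t + x) * (2 / `|g| * (oneDsqr t)^-1)).
Proof.
move=> e0 vi.
have a0 : 0 < e / `|g| by rewrite divr_gt0.
have ik : intg (fun y => poisson g e (x - y) * v y).
  apply: (@integrable_bounded_mul _ _ _ (2 / e)) => //; first exact: measurable_poissonB.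
  by move=> y; exact: poisson_le.
rewrite /poissonT (Rintegral_affine x a0 ik) -RintegralZl//; last exact: (integrable_affine x a0 ik).
apply: eq_Rintegral => t _; rewrite mulrA mulrC; congr (_ * _).
rewrite /poisson /oneDsqr.
have -> : (g * (x - (e / `|g| * t + x))) ^+ 2 = e ^+ 2 * t ^+ 2.
  transitivity (`|g| ^+ 2 * (e / `|g| * t) ^+ 2).
    by rewrite real_normK ?num_real// -exprMn -sqrrN; congr (_ ^+ 2); ring.
  by field; rewrite lt0r_neq0.
field.
by rewrite !lt0r_neq0// ltr_wpDr ?sqr_ge0// exprn_gt0.
Qed.

Lemma cvg_poissonT_form_continuous (v : R -> R) (M : R) : continuous v ->
  (forall x, `|v x| <= M) -> intg v ->
  \int[mu]_x (v x * poissonT g (n.+1%:R^-1) v x) @[n --> \oo] -->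
  kappa * \int[mu]_x (v x ^+ 2).
Proof.
move=> cv vM vi.
have mv : measurable_fun [set: R] v by exact: continuous_measurable_fun.
have e0 n : 0 < n.+1%:R^-1 :> R by rewrite invr_gt0.
have M0 : 0 <= M by rewrite (le_trans _ (vM 0)).
have o0 t : 0 < oneDsqr t :> R by rewrite (lt_le_trans ltr01)// oneDsqr_ge1.
have mo : measurable_fun [set: R] (fun t : R => (oneDsqr t)^-1).
  by apply: continuous_measurable_fun; exact: (@continuous_oneDsqrV R).
have io : intg (fun t : R => (oneDsqr t)^-1).
  apply/integrableP; split; first exact/measurable_EFinP.
  under eq_integral do rewrite /= ger0_norm ?invr_ge0 ?ltW//.
  by rewrite integral_oneDsqrV ltry.
have Eo : \int[mu]_t (oneDsqr t)^-1 = pi :> R.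
  by apply: EFin_inj; rewrite EFin_Rintegral// integral_oneDsqrV.
have ik : intg (fun t => 2 / `|g| * (oneDsqr t)^-1) by exact: integrableZl_EFin.
have k0 t : 0 <= 2 / `|g| * (oneDsqr t)^-1.
  by rewrite mulr_ge0 ?divr_ge0 ?invr_ge0 ?ltW.
have Ek : \int[mu]_t (2 / `|g| * (oneDsqr t)^-1) = kappa.
  by rewrite RintegralZl// Eo /kappa; ring.
have mva n x : measurable_fun [set: R] (fun t => v (n.+1%:R^-1 / `|g| * t + x)).
  apply: (measurableT_comp mv); apply: measurable_funD => //; exact: mulrl_measurable.
(* Approximate identity at a point: the argument of [v] tends to x, [v] is continuous there, and [M]
   times the fixed kernel dominates. *)
have Pcvg x : poissonT g (n.+1%:R^-1) v x @[n --> \oo] --> kappa * v x.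
  have -> : kappa * v x = \int[mu]_t (v x * (2 / `|g| * (oneDsqr t)^-1)).
    by rewrite RintegralZl// Ek mulrC.
  under eq_fun do rewrite poissonT_dilation//.
  apply: (@dominated_Rintegral_cvg _ _ _ (fun t => M * (2 / `|g| * (oneDsqr t)^-1))).
  - by move=> n; apply: measurable_funM => //; exact: measurable_funM.
  - by apply: measurable_funM => //; exact: measurable_funM.
  - move=> t; apply: cvgM; last exact: cvg_cst.
    apply: continuous_cvg; first exact: cv.
    rewrite -[X in _ --> X]add0r; apply: cvgD; last exact: cvg_cst.
    rewrite -(mul0r t); apply: cvgM; last exact: cvg_cst.
    rewrite -(mul0r `|g|^-1); apply: cvgM; last exact: cvg_cst.
    exact: cvg_harmonic.
  - exact: integrableZl_EFin.
  - by move=> n t; rewrite normrM (ger0_norm (k0 t)) ler_wpM2r.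
have v2i : intg (fun x => v x ^+ 2).
  by under eq_fun do rewrite expr2; exact: (integrable_bounded_mul mv vM vi).
rewrite -RintegralZl//.
(* The Poisson integrals of [v] are bounded by M times the kernel mass [kappa], uniformly in n, so
   integrability of [v] gives the dominating function. *)
apply: (@dominated_Rintegral_cvg _ _ _ (fun x => `|v x| * (M * kappa))).
- move=> n; apply: measurable_funM => //.
  by apply: continuous_measurable_fun; exact: continuous_poissonT.
- by apply: measurable_funM => //; exact: measurable_funX.
- move=> x.
  have -> : kappa * v x ^+ 2 = v x * (kappa * v x) by ring.
  by apply: cvgM; first exact: cvg_cst.
- by apply: integrableZr_EFin; exact: integrable_norm.
- move=> n x; rewrite normrM ler_wpM2l// poissonT_dilation//.
  have -> : M * kappa = M * \int[mu]_t `|2 / `|g| * (oneDsqr t)^-1|.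
    by rewrite -Ek; congr (_ * _); apply: eq_Rintegral => t _; rewrite (ger0_norm (k0 t)).
  by apply: norm_Rintegral_bounded_mul.
Qed.

Lemma plancherel_cosT_sinT_continuous (v : R -> R) (M : R) : continuous v ->
  (forall x, `|v x| <= M) -> intg v ->
  (\int[mu]_s (cosT g v s ^+ 2 + sinT g v s ^+ 2)%:E =
   (kappa * \int[mu]_x (v x ^+ 2))%:E)%E.
Proof.
move=> cv vM vi; rewrite -(cvg_lim _ (cvg_poissonT_form vi))//.
apply/cvg_lim => //; apply: cvg_EFin; first exact: nearW.
exact: cvg_poissonT_form_continuous vM vi.
Qed.

End abel_limit.

(** * Density of bounded continuous functions *)

Section continuous_density.
Context {R : realType}.
Local Notation mu := (@lebesgue_measure R).
Local Notation intg f := (mu.-integrable setT (EFin \o f)).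

(** Cutting argument and value together leaves a bounded function of bounded support. Each x is kept
    once n exceeds both |x| and |u x|, so the integrand is eventually 0, and u^2 dominates it. *)
Lemma truncation_cvg (u : R -> R) : measurable_fun [set: R] u -> intg (fun x => u x ^+ 2) ->
  \int[mu]_x (u x - u x * \1_(`[- n%:R, n%:R] `&` u @^-1` `[- n%:R, n%:R]) x) ^+ 2
    @[n --> \oo] --> (0 : R).
Proof.
move=> mu_ u2i; set A := fun n : nat => `[- n%:R, n%:R] `&` u @^-1` `[- n%:R, n%:R].
have mA n : measurable (A n).
  by apply: measurableI => //; rewrite -[X in measurable X]setTI; exact: mu_.
have := @dominated_Rintegral_cvg _ (fun n x => (u x - u x * \1_(A n) x) ^+ 2) (cst 0)
  (fun x => u x ^+ 2).
rewrite [X in _ --> X]Rintegral_cst//= mul0r; apply => //.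
- move=> n; apply: measurable_funX; apply: measurable_funB => //.
  by apply: measurable_funM => //; exact: measurable_indic.
- move=> x; apply: cvg_near_cst; near=> n.
  have xn : `|x| <= n%:R by near: n; exact: nbhs_infty_ger.
  have un : `|u x| <= n%:R by near: n; exact: nbhs_infty_ger.
  rewrite indicE mem_set ?mulr1 ?subrr ?expr0n//.
  by rewrite /A; split => /=; rewrite in_itv/= -ler_norml.
- move=> n x; rewrite ger0_norm ?sqr_ge0// indicE; case: (x \in _).
    by rewrite mulr1 subrr expr0n sqr_ge0.
  by rewrite mulr0 subr0.
Unshelve. all: end_near. Qed.

Definition clip (N y : R) : R := Num.max (- N) (Num.min N y).

Lemma norm_clip_le (N y : R) : 0 <= N -> `|clip N y| <= N.
Proof.
move=> N0; rewrite /clip ler_norml; apply/andP; split.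
  by rewrite le_max lexx.
by rewrite ge_max; apply/andP; split; [lra|rewrite ge_min lexx].
Qed.

Lemma clip_id (N y : R) : `|y| <= N -> clip N y = y.
Proof.
by rewrite ler_norml => /andP[h1 h2]; rewrite /clip (min_idPr h2) (max_idPr h1).
Qed.

Lemma clipP (N y : R) : 0 <= N ->
  [\/ clip N y = N /\ N <= y, clip N y = - N /\ y <= - N |
      clip N y = y /\ - N <= y <= N].
Proof.
move=> N0; rewrite /clip; have [Ny|Ny] := leP N y.
  by rewrite max_r; [apply: Or31|lra].
by have [Nm|Nm] := leP (- N) y; [apply: Or33; split => //=; exact: ltW|apply: Or32; split => //; exact: ltW].
Qed.

Lemma clip_lipschitz (N x y : R) : 0 <= N -> `|clip N x - clip N y| <= `|x - y|.
Proof.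
move=> N0.
have h1 := ler_norm (x - y); have h2 := ler_norm (y - x); rewrite distrC in h2.
rewrite ler_norml; case: (clipP x N0) => [] [-> ?]; case: (clipP y N0) => [] [-> ?];
  apply/andP; split; lra.
Qed.

Lemma continuous_clip (N : R) : 0 <= N -> continuous (clip N).
Proof.
move=> N0 y; apply/cvgrPdist_lt => e e0; near=> x.
rewrite (le_lt_trans (clip_lipschitz _ _ N0))//.
Unshelve. all: end_near. Qed.

(** Approximation by continuous functions is available in L1 on a set of finite measure. Clipping
    the approximant to [-N, N] gives |w - v| <= 2 N, hence |w - v|^2 <= 2 N |w - v|, which turns L1
    closeness into L2 closeness; a continuous cutoff makes [v] integrable on the line. *)
Lemma approx_bounded_support (w : R -> R) (N e : R) : 0 <= N -> 0 < e ->
  measurable_fun [set: R] w ->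
  (forall x, `|w x| <= N) -> (forall x, N < `|x| -> w x = 0) ->
  exists v : R -> R, [/\ continuous v, forall x, `|v x| <= N, intg v &
    intg (fun x => (w x - v x) ^+ 2) /\ \int[mu]_x ((w x - v x) ^+ 2) < e].
Proof.
move=> N0 e0 mw wN w0.
pose E : set R := `[- (N + 1), N + 1]%classic.
have mE : measurable E by exact: measurable_itv.
have muE : (mu E < +oo)%E by rewrite lebesgue_measure_itv/=; case: ifPn; rewrite ltry.
have wi : mu.-integrable E (EFin \o w).
  apply: measurable_bounded_integrable => //; first exact: measurable_funTS.
  by exists N; split; [exact: num_real|move=> x Nx y _ /=; exact: le_trans (wN y) (ltW Nx)].
have [h_ [ch hi hw]] := approximation_continuous_integrable mE muE wi.
(* Chosen so that 2 N d < e; the added 1 covers N = 0. *)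
pose d := e / (2 * N + 1).
have d0 : 0 < d by rewrite divr_gt0//; lra.
have [n hn] : exists n, (\int[mu]_(z in E) `|(w z - h_ n z)%:E| < d%:E)%E.
  have /fine_cvgP[[m _ mfin] /cvgrPdist_lt/(_ _ d0)[k _ kd]] := hw.
  exists (m + k)%N; have := kd (m + k)%N (leq_addl _ _).
  rewrite sub0r normrN /= ger0_norm ?fine_ge0 ?integral_ge0// => hd.
  by rewrite -[ltLHS]fineK ?lte_fin//; apply: mfin => /=; exact: leq_addr.
pose h := h_ n.
(* The trapezoid N + 1 - |x| clamped to [0, 1], written through [clip 1] by an affine change because
   [clip] is symmetric about 0. *)
pose chi (x : R) := (clip 1 (2 * (N + 1 - `|x|) - 1) + 1) / 2.
pose v x := clip N (h x) * chi x.
have chi_in x : `|x| <= N -> chi x = 1.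
  by rewrite /chi => xN; case: (clipP (2 * (N + 1 - `|x|) - 1) ler01) => -[-> ?]; lra.
have chi_out x : N + 1 < `|x| -> chi x = 0.
  by rewrite /chi => xN; case: (clipP (2 * (N + 1 - `|x|) - 1) ler01) => -[-> ?]; lra.
have chi_01 x : 0 <= chi x <= 1.
  rewrite /chi; case: (clipP (2 * (N + 1 - `|x|) - 1) ler01) => -[-> ?];
    apply/andP; split; lra.
have cchi : continuous chi.
  move=> x; apply: cvgM; last exact: cvg_cst.
  apply: cvgD; last exact: cvg_cst.
  apply: continuous_cvg; first exact: continuous_clip.
  apply: cvgB; last exact: cvg_cst.
  apply: cvgM; first exact: cvg_cst.
  apply: cvgB; first exact: cvg_cst.
  exact: norm_continuous.
have cv : continuous v.
  move=> x; apply: cvgM; last exact: cchi.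
  by apply: continuous_cvg; [exact: continuous_clip|exact: ch].
have vN x : `|v x| <= N.
  have /andP[c0 c1] := chi_01 x.
  by rewrite /v normrM (ger0_norm c0) -[leRHS]mulr1 ler_pM ?norm_clip_le.
have vE x : ~ E x -> v x = 0.
  rewrite /E/= in_itv/= -ler_norml => /negP; rewrite -ltNge => xN.
  by rewrite /v chi_out// mulr0.
have iE : intg (fun x => N * \1_E x).
  by apply: integrableZl_EFin; exact: integrable_indic_itv.
have mv : measurable_fun [set: R] v by exact: continuous_measurable_fun.
have vi : intg v.
  apply: (@le_integrable_EFin _ _ (fun x => N * \1_E x)) => // x.
  rewrite indicE; case: (boolP (x \in E)) => [_|]; first by rewrite mulr1.
  by rewrite notin_setE => /vE ->; rewrite normr0 mulr0.
(* Three regions: off [E] both functions vanish; for |x| <= N the cutoff is 1 and [clip N] fixes w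
   x; in between w x = 0, which [clip N] also fixes. *)
have wv1 x : `|w x - v x| <= `|w x - h x| * \1_E x.
  rewrite indicE; case: (boolP (x \in E)) => [xE|]; last first.
    rewrite notin_setE => nE; rewrite vE// w0 ?subrr ?normr0 ?mulr0//.
    move: nE; rewrite /E/= in_itv/= -ler_norml => /negP; rewrite -ltNge; lra.
  rewrite mulr1; have [xN|Nx] := leP `|x| N.
    rewrite /v chi_in// mulr1 -{1}(clip_id (wN x)); exact: clip_lipschitz.
  have /andP[c0 c1] := chi_01 x.
  rewrite w0// !sub0r !normrN /v normrM (ger0_norm c0) -[leRHS]mulr1 ler_pM//.
  have := clip_lipschitz (h x) 0 N0.
  by rewrite (clip_id (y := 0)) ?normr0// !subr0.
have wv x : (w x - v x) ^+ 2 <= 2 * N * (`|w x - h x| * \1_E x).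
  rewrite -[leLHS]real_normK ?num_real// expr2 ler_pM//.
  by rewrite (le_trans (ler_normB _ _))// mulr_natl mulr2n lerD.
have whi : mu.-integrable E (EFin \o (fun x => w x - h x)).
  have hB : mu.-integrable E ((EFin \o w) \- (EFin \o h_ n))%E by exact: integrableB.
  by apply: eq_integrable hB => // x _; rewrite /= EFinB.
have whE : intg (fun x => `|w x - h x| * \1_E x).
  have hE := (@integrable_mkcond _ _ R mu E _ mE).1 (integrable_norm whi).
  apply: eq_integrable hE => // x _.
  by rewrite /patch /= indicE; case: (x \in E); rewrite ?mulr1 ?mulr0.
have wv2i : intg (fun x => (w x - v x) ^+ 2).
  apply: (@le_integrable_EFin _ _ (fun x => 2 * N * (`|w x - h x| * \1_E x))).
  - by apply: measurable_funX; exact: measurable_funB.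
  - by move=> x; rewrite ger0_norm ?sqr_ge0.
  - exact: integrableZl_EFin.
exists v; split => //; split => //.
apply: (@le_lt_trans _ _ (2 * N * \int[mu]_x (`|w x - h x| * \1_E x))).
  by rewrite -RintegralZl//; apply: le_Rintegral => //; exact: integrableZl_EFin.
have hd : \int[mu]_x (`|w x - h x| * \1_E x) < d.
  rewrite -lte_fin EFin_Rintegral//; move: hn; rewrite integral_mkcond => hn.
  rewrite (le_lt_trans _ hn)// le_eqVlt; apply/orP; left; apply/eqP.
  apply: eq_integral => x _.
  by rewrite /patch /= indicE; case: (x \in E); rewrite ?mulr1 ?mulr0.
 apply: (@le_lt_trans _ _ (2 * N * d)).
  by rewrite ler_wpM2l ?mulr_ge0// ltW.
rewrite /d mulrA ltr_pdivrMr; last by lra.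
by rewrite mulrC; nra.
Qed.

Lemma continuous_dense (u : R -> R) (e : R) : 0 < e -> intg u -> intg (fun x => u x ^+ 2) ->
  exists v : R -> R, exists M, [/\ continuous v, forall x, `|v x| <= M, intg v &
    intg (fun x => (u x - v x) ^+ 2) /\ \int[mu]_x ((u x - v x) ^+ 2) < e].
Proof.
move=> e0 ui u2i.
have mu_ : measurable_fun [set: R] u by apply/measurable_EFinP; exact: measurable_int ui.
(* Two errors below e / 4, each doubled by (a + b)^2 <= 2 a^2 + 2 b^2, add up to less than e. *)
have e40 : 0 < e / 4 by rewrite divr_gt0.
have /cvgrPdist_lt/(_ _ e40)[n _ /(_ n (leqnn n))] := truncation_cvg mu_ u2i.
set A := _ `&` _; pose w x := u x * \1_A x.
rewrite sub0r normrN => /= wn.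
have mA : measurable A.
  by apply: measurableI => //; rewrite -[X in measurable X]setTI; exact: mu_.
have mw : measurable_fun [set: R] w by apply: measurable_funM => //; exact: measurable_indic.
have wN x : `|w x| <= n%:R.
  rewrite /w indicE; case: (boolP (x \in A)) => [|_]; last by rewrite mulr0 normr0.
  by rewrite inE mulr1 => -[_ /=]; rewrite in_itv/= -ler_norml.
have w0 x : n%:R < `|x| -> w x = 0.
  move=> nx; rewrite /w indicE; case: (boolP (x \in A)) => [|_]; last by rewrite mulr0.
  by rewrite inE => -[/=]; rewrite in_itv/= -ler_norml leNgt nx.
have [v [cv vN vi [wvi wv]]] := approx_bounded_support (ler0n _ n) e40 mw wN w0.
exists v, n%:R; split => //.
have uwi : intg (fun x => (u x - w x) ^+ 2).
  apply: (@le_integrable_EFin _ _ (fun x => u x ^+ 2)) => //.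
    by apply: measurable_funX; exact: measurable_funB.
  move=> x; rewrite ger0_norm ?sqr_ge0// /w indicE; case: (x \in _).
    by rewrite mulr1 subrr expr0n sqr_ge0.
  by rewrite mulr0 subr0.
have uv x : (u x - v x) ^+ 2 <= 2 * (u x - w x) ^+ 2 + 2 * (w x - v x) ^+ 2.
  by have := sqr_ge0 (u x - w x - (w x - v x)); nra.
have si : intg (fun x => 2 * (u x - w x) ^+ 2 + 2 * (w x - v x) ^+ 2).
  by apply: integrableD_EFin; exact: integrableZl_EFin.
have mv : measurable_fun [set: R] v by exact: continuous_measurable_fun.
have uvi : intg (fun x => (u x - v x) ^+ 2).
  apply: le_integrable_EFin si; first by apply: measurable_funX; exact: measurable_funB.
  by move=> x; rewrite ger0_norm ?sqr_ge0.
split => //.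
apply: (@le_lt_trans _ _ (2 * \int[mu]_x (u x - w x) ^+ 2 + 2 * \int[mu]_x (w x - v x) ^+ 2)).
  rewrite -!RintegralZl// -RintegralD//; last 2 first.
  - exact: integrableZl_EFin.
  - exact: integrableZl_EFin.
  exact: le_Rintegral.
rewrite ger0_norm in wn; last by apply: Rintegral_ge0 => x _; rewrite sqr_ge0.
by rewrite -/w in wn; lra.
Qed.

End continuous_density.

(** * Square-integrable complex-valued functions *)

Section complex_L2.
Context {R : realType}.
Local Notation mu := (@lebesgue_measure R).
Local Notation intg f := (mu.-integrable setT (EFin \o f)).
Implicit Types (f g : R -> R[i]) (z w : R[i]).

Definition nsq z : R := complex.Re z ^+ 2 + complex.Im z ^+ 2.
(** A real integral sends an infinite value to 0, so this is the squared norm on [L2], to which the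
    estimates below are confined. *)
Definition n2 f : R := \int[mu]_t nsq (f t).
Definition L2 f := cmeasurable f /\ intg (fun t => nsq (f t)).

Lemma nsq_ge0 z : 0 <= nsq z.
Proof. by rewrite addr_ge0 ?sqr_ge0. Qed.

Lemma nsqM z w : nsq (z * w) = nsq z * nsq w.
Proof. by case: z w => [a b] [c d]; rewrite /nsq /=; ring. Qed.

Lemma nsqN z : nsq (- z) = nsq z.
Proof. by case: z => a b; rewrite /nsq /= !sqrrN. Qed.

Lemma sqr_normc_nsq z : Normc.normc z ^+ 2 = nsq z.
Proof. by case: z => a b; rewrite /= sqr_sqrtr// addr_ge0 ?sqr_ge0. Qed.

(** Weighted Young inequality, from the square (e a - b)^2 on each component. The weight on [z] can
    be brought arbitrarily close to 1, which makes squared norms behave continuously. *)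
Lemma nsqD_eta (e : R) z w : 0 < e ->
  nsq (z + w) <= (1 + e) * nsq z + (1 + e^-1) * nsq w.
Proof.
move=> e0; have young (a b : R) : (a + b) ^+ 2 <= (1 + e) * a ^+ 2 + (1 + e^-1) * b ^+ 2.
  rewrite -subr_ge0.
  have -> : (1 + e) * a ^+ 2 + (1 + e^-1) * b ^+ 2 - (a + b) ^+ 2 = e^-1 * (e * a - b) ^+ 2.
    by field; exact: lt0r_neq0.
  by rewrite mulr_ge0 ?sqr_ge0// invr_ge0 ltW.
case: z w => [a b] [c d]; rewrite /nsq /=.
by have := young a c; have := young b d; lra.
Qed.

Lemma cmeasurableD f g : cmeasurable f -> cmeasurable g -> cmeasurable (fun t => f t + g t).
Proof.
move=> [f1 f2] [g1 g2]; split.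
- apply: (eq_measurable_fun (fun t => complex.Re (f t) + complex.Re (g t))).
    by move=> t _; case: (f t) (g t) => [a b] [c d].
  exact: measurable_funD.
- apply: (eq_measurable_fun (fun t => complex.Im (f t) + complex.Im (g t))).
    by move=> t _; case: (f t) (g t) => [a b] [c d].
  exact: measurable_funD.
Qed.

Lemma cmeasurableM f g : cmeasurable f -> cmeasurable g -> cmeasurable (fun t => f t * g t).
Proof.
move=> [f1 f2] [g1 g2]; split.
- apply: (eq_measurable_fun (fun t => complex.Re (f t) * complex.Re (g t) - complex.Im (f t) * complex.Im (g t))).
    by move=> t _; case: (f t) (g t) => [a b] [c d].
  by apply: measurable_funB; exact: measurable_funM.
- apply: (eq_measurable_fun (fun t => complex.Re (f t) * complex.Im (g t) + complex.Im (f t) * complex.Re (g t))).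
    by move=> t _; case: (f t) (g t) => [a b] [c d].
  by apply: measurable_funD; exact: measurable_funM.
Qed.

Lemma cmeasurable_cst z : cmeasurable (fun _ : R => z).
Proof. by split; exact: measurable_cst. Qed.

Lemma measurable_nsq f : cmeasurable f -> measurable_fun [set: R] (fun t => nsq (f t)).
Proof. by move=> [f1 f2]; apply: measurable_funD; exact: measurable_funX. Qed.

Lemma L2D f g : L2 f -> L2 g -> L2 (fun t => f t + g t).
Proof.
move=> [mf fi] [mg gi]; have mfg := cmeasurableD mf mg; split => //.
apply: (@le_integrable_EFin _ _ (fun t => (1 + 1) * nsq (f t) + (1 + 1^-1) * nsq (g t))).
- exact: measurable_nsq.
- by move=> t; rewrite ger0_norm ?nsq_ge0// nsqD_eta.
- by apply: integrableD_EFin; exact: integrableZl_EFin.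
Qed.

Lemma L2Z w f : L2 f -> L2 (fun t => w * f t).
Proof.
move=> [mf fi]; split; first exact/cmeasurableM/mf/cmeasurable_cst.
by under eq_fun do rewrite nsqM; exact: integrableZl_EFin.
Qed.

Lemma L2B f g : L2 f -> L2 g -> L2 (fun t => f t - g t).
Proof.
move=> Lf Lg; have := L2D Lf (L2Z (-1) Lg).
by under eq_fun do rewrite mulN1r.
Qed.

Lemma n2_ge0 f : 0 <= n2 f.
Proof. by apply: Rintegral_ge0 => t _; exact: nsq_ge0. Qed.

Lemma n2Z w f : L2 f -> n2 (fun t => w * f t) = nsq w * n2 f.
Proof.
by move=> [_ fi]; rewrite /n2 -RintegralZl//; apply: eq_Rintegral => t _; rewrite nsqM.
Qed.

Lemma n2D_eta e f g : 0 < e -> L2 f -> L2 g ->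
  n2 (fun t => f t + g t) <= (1 + e) * n2 f + (1 + e^-1) * n2 g.
Proof.
move=> e0 Lf Lg; have [_ fi] := Lf; have [_ gi] := Lg; have [_ fgi] := L2D Lf Lg.
rewrite /n2 -!RintegralZl// -RintegralD//; last 2 first.
- exact: integrableZl_EFin.
- exact: integrableZl_EFin.
apply: le_Rintegral => //.
- by apply: integrableD_EFin; exact: integrableZl_EFin.
- by move=> t _; exact: nsqD_eta.
Qed.

Lemma n2D_le f g : L2 f -> L2 g -> n2 (fun t => f t + g t) <= 2 * n2 f + 2 * n2 g.
Proof. by move=> Lf Lg; have := n2D_eta ltr01 Lf Lg; rewrite invr1. Qed.

Lemma n2_distC f g : n2 (fun t => f t - g t) = n2 (fun t => g t - f t).
Proof. by apply: eq_Rintegral => t _; rewrite -nsqN opprB. Qed.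

(** Continuity of the squared norm with the functions abstracted away: [a] and [l] are squared
    norms, [d] squared distances, and the two inequalities are the instances of Young in both
    directions. *)
Lemma quad_close_cvg (a d : nat -> R) (l : R) :
  (forall n, 0 <= a n) -> 0 <= l -> (forall n, 0 <= d n) ->
  (forall n e, 0 < e -> a n <= (1 + e) * l + (1 + e^-1) * d n) ->
  (forall n e, 0 < e -> l <= (1 + e) * a n + (1 + e^-1) * d n) ->
  d n @[n --> \oo] --> 0 -> a n @[n --> \oo] --> l.
Proof.
move=> a0 l0 d0 al la dcvg; apply/cvgrPdist_lt => e e0.
(* [B] exceeds [l] and, once d n < 1, also a n (Young with e = 1). Then [h] keeps h l and h (a n)
   below e / 2, and [q] does the same for (1 + 1/h) d n. *)
pose B := 2 * l + 2 + 1.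
have B0 : 0 < B by rewrite /B; lra.
pose h := e / (2 * B).
have h0 : 0 < h by rewrite divr_gt0// mulr_gt0.
pose q := e / (2 * (1 + h^-1)).
have hi : 0 < 1 + h^-1 by rewrite ltr_wpDr// invr_ge0 ltW.
have q0 : 0 < q by rewrite divr_gt0// mulr_gt0.
near=> n.
have dn1 : d n < 1.
  by near: n; apply: (cvgr_lt 0) => //; exact: ltr01.
have dnq : d n < q by near: n; exact: (cvgr_lt 0).
have aB : a n <= 2 * l + 2.
  by have := al n 1 ltr01; rewrite invr1; lra.
have := al n h h0; have := la n h h0.
have hB : h * B = e / 2 by rewrite /h; field; exact: lt0r_neq0.
have qe : (1 + h^-1) * q = e / 2.
  by rewrite /q; field; rewrite !lt0r_neq0//; lra.
have hl : h * l <= h * B by rewrite ler_wpM2l ?ltW// /B; lra.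
have ha : h * a n <= h * B by rewrite ler_wpM2l ?ltW// /B; lra.
have dq : (1 + h^-1) * d n < (1 + h^-1) * q by rewrite ltr_pM2l.
by rewrite ltr_norml => *; apply/andP; split; lra.
Unshelve. all: end_near. Qed.

Lemma n2_cvg (f_ : nat -> R -> R[i]) f : L2 f -> (forall n, L2 (f_ n)) ->
  n2 (fun t => f_ n t - f t) @[n --> \oo] --> 0 -> n2 (f_ n) @[n --> \oo] --> n2 f.
Proof.
move=> Lf Lf_ h; apply: (quad_close_cvg _ _ _ _ _ h).
- by move=> n; exact: n2_ge0.
- exact: n2_ge0.
- by move=> n; exact: n2_ge0.
- move=> n e e0; have := n2D_eta e0 Lf (L2B (Lf_ n) Lf).
  by under eq_fun do rewrite addrC subrK.
- move=> n e e0; rewrite n2_distC; have := n2D_eta e0 (Lf_ n) (L2B Lf (Lf_ n)).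
  by under eq_fun do rewrite addrC subrK.
Qed.

Lemma n2_ae_eq f g : cmeasurable f -> cmeasurable g ->
  {ae mu, forall t, f t = g t} -> n2 f = n2 g.
Proof.
move=> mf mg fg; rewrite /n2 /Rintegral; congr fine.
apply: ae_eq_integral => //.
- by apply/measurable_EFinP; exact: measurable_nsq.
- by apply/measurable_EFinP; exact: measurable_nsq.
- by apply: (@filterS _ _ (ae_filter_ringOfSetsType mu) _ _ _ fg) => t ->.
Qed.

(** All four terms keep the shape f + w g, with explicit factors 1 and -1, so that a single isometry
    statement with a scalar [w] rewrites each of them. *)
Lemma inner_polarization f g : L2 f -> L2 g ->
  inner f g =
    ((n2 (fun t => f t + 1 * g t) - n2 (fun t => f t + -1 * g t)) / 4) +i*
    ((n2 (fun t => f t + 'i%C * g t) - n2 (fun t => f t + - 'i%C * g t)) / 4).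
Proof.
move=> Lf Lg.
have Lw w : intg (fun t => nsq (f t + w * g t)).
  by have [] := L2D Lf (L2Z w Lg).
rewrite /inner /cintegral /n2; congr (_ +i* _); rewrite -RintegralB// -RintegralZr//.
- by apply: eq_Rintegral => t _; case: (f t) (g t) => [a b] [c d]; rewrite /nsq /=; field.
- by have := integrableB measurableT (Lw 1) (Lw (-1)).
- by apply: eq_Rintegral => t _; case: (f t) (g t) => [a b] [c d]; rewrite /nsq /=; field.
- by have := integrableB measurableT (Lw 'i%C) (Lw (- 'i%C)).
Qed.

Lemma cLnorm2_sqrte f : cLnorm 2%:E f = sqrte (\int[mu]_t (nsq (f t))%:E)%E.
Proof.
rewrite /cLnorm unlock -poweR12_sqrt; last first.
  by apply: integral_ge0 => t _; rewrite lee_fin nsq_ge0.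
congr (_ `^ _)%E; apply: eq_integral => t _.
have n0 : 0 <= Normc.normc (f t) by case: (f t) => a b; exact: sqrtr_ge0.
by rewrite abse_EFin ger0_norm// poweR_EFin powR_mulrn// sqr_normc_nsq.
Qed.

Lemma cLnorm2_sqr f : (cLnorm 2%:E f ^+ 2 = \int[mu]_t (nsq (f t))%:E)%E.
Proof.
rewrite cLnorm2_sqrte sqr_sqrte//.
by apply: integral_ge0 => t _; rewrite lee_fin nsq_ge0.
Qed.

Lemma cLnorm2E f : L2 f -> cLnorm 2%:E f = (Num.sqrt (n2 f))%:E.
Proof. by move=> [_ fi]; rewrite cLnorm2_sqrte -EFin_Rintegral. Qed.

Lemma in_L2P f : in_Lp 2%:E f <-> L2 f.
Proof.
split=> [[mf fy]|Lf]; last first.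
  by split; [case: Lf|rewrite cLnorm2E// ltry].
split=> //; apply/integrableP; split; first by apply/measurable_EFinP; exact: measurable_nsq.
under eq_integral do rewrite /= ger0_norm ?nsq_ge0//.
have I0 : (0 <= \int[mu]_t (nsq (f t))%:E)%E.
  by apply: integral_ge0 => t _; rewrite lee_fin nsq_ge0.
by move: fy; rewrite cLnorm2_sqrte -!ge0_fin_numE ?sqrte_ge0// sqrte_fin_num.
Qed.

Lemma in_L1P f : in_Lp 1%:E f <->
  intg (fun t => complex.Re (f t)) /\ intg (fun t => complex.Im (f t)).
Proof.
have n0 z : 0 <= Normc.normc z by case: z => a b; exact: sqrtr_ge0.
have cL1 : cLnorm 1%:E f = (\int[mu]_t (Normc.normc (f t))%:E)%E.
  by rewrite /cLnorm Lnorm1; apply: eq_integral => t _; rewrite abse_EFin ger0_norm.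
have mn : cmeasurable f -> measurable_fun [set: R] (fun t => Normc.normc (f t)).
  move=> mf; under eq_fun do (rewrite -[Normc.normc _]ger0_norm// -sqrtr_sqr sqr_normc_nsq).
  apply: (@measurableT_comp _ _ _ _ _ _ (@Num.sqrt R)); last exact: measurable_nsq.
  by apply: continuous_measurable_fun; exact: sqrt_continuous.
split=> [[mf]|[f1 f2]].
  rewrite cL1 => fy.
  have ni : intg (fun t => Normc.normc (f t)).
    apply/integrableP; split; first by apply/measurable_EFinP; exact: mn.
    by under eq_integral do rewrite /= ger0_norm//.
  have [m1 m2] := mf.
  split; apply: le_integrable_EFin ni => //.
    move=> t; case: (f t) => a b /=; rewrite -sqrtr_sqr ler_wsqrtr//.
    by rewrite lerDl sqr_ge0.
  move=> t; case: (f t) => a b /=; rewrite -sqrtr_sqr ler_wsqrtr//.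
  by rewrite lerDr sqr_ge0.
have mf : cmeasurable f.
  by split; apply/measurable_EFinP; [exact: measurable_int f1|exact: measurable_int f2].
split => //; rewrite cL1.
have si := integrableD_EFin (integrable_norm f1) (integrable_norm f2).
have ni : intg (fun t => Normc.normc (f t)).
  apply: le_integrable_EFin si; first exact: mn.
  move=> t; rewrite ger0_norm//=; case: (f t) => a b /=.
  rewrite -[leRHS]ger0_norm ?addr_ge0// -sqrtr_sqr ler_wsqrtr//.
  rewrite -(real_normK (num_real a)) -(real_normK (num_real b)).
  by have := normr_ge0 a; have := normr_ge0 b; nra.
by rewrite -EFin_Rintegral// ltry.
Qed.

End complex_L2.

(** * Completeness of real L2 for geometrically Cauchy sequences *)

Section L2_completeness.
Context {R : realType}.
Local Notation mu := (@lebesgue_measure R).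
Local Notation intg f := (mu.-integrable setT (EFin \o f)).

Lemma limn_einf_le (a : nat -> \bar R) (c : \bar R) (N : nat) :
  (forall n, (N <= n)%N -> (a n <= c)%E) -> (limn_einf a <= c)%E.
Proof.
move=> ac; rewrite limn_einf_lim; apply: lime_le; first exact: is_cvg_einfs.
near=> n; apply: (@le_trans _ _ (a n)).
  by apply: ereal_inf_lbound; exists n => /=.
by apply: ac; near: n; exact: nbhs_infty_ge.
Unshelve. all: end_near. Qed.

Lemma nneseries_geometric_lty (C : R) (a : nat -> \bar R) : 0 <= C ->
  (forall n, 0 <= a n)%E ->
  (forall n, a n <= (C * (2^-1) ^+ n)%:E)%E -> (\sum_(n <oo) a n < +oo)%E.
Proof.
move=> C0 a0 aC; apply: (@le_lt_trans _ _ (C * 2)%:E); last exact: ltry.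
apply: lime_le; first by apply: is_cvg_nneseries => n _ _; exact: a0.
apply: nearW => n; apply: (@le_trans _ _ (\sum_(0 <= i < n) (C * (2^-1) ^+ i)%:E)%E).
  by apply: lee_sum => i _.
rewrite sumEFin lee_fin -mulr_sumr ler_wpM2l//.
have : series (geometric 1 2^-1) n <= (2 : R).
  rewrite geometric_seriesE; last by lra.
  have : 0 <= (2^-1 : R) ^+ n by rewrite exprn_ge0.
  by rewrite ler_pdivrMr; lra.
rewrite /series /geometric /=.
by under [X in X <= _ -> _]eq_bigr do rewrite mul1r.
Qed.

(* For the increments y_n of x, |y_n| <= (2^n y_n^2 + 2^-n) / 2 turns summability of
   2^n y_n^2 into absolute convergence of the telescoping series. *)
Lemma cvgn_weighted_square_increments (x : nat -> R) :
  (\sum_(n <oo) (2 ^+ n * (x n.+1 - x n) ^+ 2)%:E < +oo)%E -> cvgn x.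
Proof.
move=> Sy.
have d0 n : 0 <= 2 ^+ n * (x n.+1 - x n) ^+ 2 by rewrite mulr_ge0 ?sqr_ge0 ?exprn_ge0.
have cd : cvgn (series (fun n => 2 ^+ n * (x n.+1 - x n) ^+ 2)).
  apply: nondecreasing_is_cvgn.
    by apply/nondecreasing_seqP => n; rewrite /series/= big_nat_recr//= lerDl.
  exists (fine (\sum_(n <oo) (2 ^+ n * (x n.+1 - x n) ^+ 2)%:E)%E) => _ [n _ <-].
  rewrite -lee_fin fineK; last by rewrite ge0_fin_numE//; apply: nneseries_ge0 => k _ _; rewrite lee_fin.
  rewrite /series /= -sumEFin; apply: nneseries_lim_ge => k _ _.
  by rewrite lee_fin; exact: d0.
have cg : cvgn (series (geometric 1 (2^-1 : R))).
  by apply: is_cvg_geometric_series; rewrite ger0_norm; lra.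
have ct : cvgn (series (telescope x)).
  apply: normed_cvg.
  apply: (@series_le_cvg _ _ (fun n => 2^-1 *: (2 ^+ n * (x n.+1 - x n) ^+ 2 + geometric 1 (2^-1 : R) n))).
  - by move=> n; exact: normr_ge0.
  - by move=> n; rewrite /GRing.scale /= mulr_ge0// addr_ge0//= mul1r exprn_ge0.
  - move=> n; rewrite /telescope /= mul1r exprVn.
    set y := x n.+1 - x n; have p0 : 0 < 2 ^+ n :> R by rewrite exprn_gt0.
    rewrite -(real_normK (num_real y)) -subr_ge0 /GRing.scale /=.
    have -> : 2^-1 * (2 ^+ n * `|y| ^+ 2 + (2 ^+ n)^-1) - `|y| =
        2^-1 * (2 ^+ n)^-1 * (2 ^+ n * `|y| - 1) ^+ 2.
      by field; exact: lt0r_neq0.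
    by rewrite mulr_ge0 ?sqr_ge0// mulr_ge0// invr_ge0 ltW.
  - by rewrite seriesZ; apply: is_cvgZr; rewrite seriesD; exact: is_cvgD.
have -> : x = (fun n => x 0%N + series (telescope x) n).
  by apply/funext => n; rewrite -eq_sum_telescope.
by apply: is_cvgD => //; exact: is_cvg_cst.
Qed.

(** Riesz-Fischer argument: weights 2^n against the decay 4^-n leave a summable 2^-n, so almost
    everywhere the weighted squared increments are summable and u n t converges. Fatou's lemma then
    hands the Cauchy bound over to the limit with the same constant. *)
Lemma L2_complete_real (u : nat -> R -> R) (C : R) :
  (forall n, measurable_fun [set: R] (u n)) ->
  (forall n m, (n <= m)%N -> intg (fun t => (u m t - u n t) ^+ 2) /\
     \int[mu]_t ((u m t - u n t) ^+ 2) <= C * (4^-1) ^+ n) ->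
  exists2 v : R -> R, measurable_fun [set: R] v &
    forall n, intg (fun t => (v t - u n t) ^+ 2) /\
      \int[mu]_t ((v t - u n t) ^+ 2) <= C * (4^-1) ^+ n.
Proof.
move=> mu_ Cu.
have C0 : 0 <= C.
  have [_] := Cu 0%N 0%N (leqnn _); rewrite expr0 mulr1; apply: le_trans.
  by apply: Rintegral_ge0 => t _; exact: sqr_ge0.
pose d n t := 2 ^+ n * (u n.+1 t - u n t) ^+ 2.
have d0 n t : 0 <= d n t by rewrite mulr_ge0 ?sqr_ge0 ?exprn_ge0.
have md n : measurable_fun [set: R] (d n).
  by apply: measurable_funM => //; apply: measurable_funX; exact: measurable_funB.
pose S t := (\sum_(n <oo) (d n t)%:E)%E.
have mS : measurable_fun [set: R] S.
  apply: (@ge0_emeasurable_sum _ _ _ _ (fun n t => (d n t)%:E) xpredT) => [n t _ _|n _].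
    by rewrite lee_fin.
  exact/measurable_EFinP.
have S0 t : (0 <= S t)%E by apply: nneseries_ge0 => n _ _; rewrite lee_fin.
have iS : mu.-integrable setT S.
  apply/integrableP; split => //.
  under eq_integral do rewrite gee0_abs//.
  rewrite /S integral_nneseries//; last 2 first.
  - by move=> n; apply/measurable_EFinP; exact: md.
  - by move=> n t _; rewrite lee_fin.
  apply: (@nneseries_geometric_lty C) => // n.
    by apply: integral_ge0 => t _; rewrite lee_fin.
  have [dni dnC] := Cu n n.+1 (leqnSn n).
  rewrite -EFin_Rintegral; last exact: integrableZl_EFin.
  rewrite RintegralZl// lee_fin.
  rewrite (le_trans (ler_wpM2l _ dnC)) ?exprn_ge0// mulrCA -exprMn.
  by rewrite (_ : 2 * 4^-1 = 2^-1 :> R)//; field.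
pose A := [set t | (S t < +oo)%E].
have mA : measurable A.
  by rewrite -[A]setTI; exact: emeasurable_fun_infty_o.
have aeA : {ae mu, forall t, A t}.
  have := integrable_ae measurableT iS.
  apply: (@filterS _ _ (ae_filter_ringOfSetsType mu)) => t /(_ Logic.I).
  by rewrite /A /= ge0_fin_numE.
(* Setting the sequence to 0 on the exceptional null set makes it converge everywhere, so the limit
   is measurable. *)
pose w n t := u n t * \1_A t.
have mw n : measurable_fun [set: R] (w n).
  by apply: measurable_funM => //; exact: measurable_indic.
have cw t : cvgn (w ^~ t).
  rewrite /w indicE; case: (boolP (t \in A)) => [|_].
    rewrite inE => At; under eq_fun do rewrite mulr1.
    exact: cvgn_weighted_square_increments At.
  by under eq_fun do rewrite mulr0; exact: is_cvg_cst.
pose v t := limn (w ^~ t).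
have mv : measurable_fun [set: R] v.
  by apply: (measurable_fun_cvg mw) => t _; exact: cw.
exists v => // n.
have mvn : measurable_fun [set: R] (fun t => (v t - u n t) ^+ 2).
  by apply: measurable_funX; exact: measurable_funB.
have E : (\int[mu]_t ((v t - u n t) ^+ 2)%:E <= (C * (4^-1) ^+ n)%:E)%E.
  have -> : (\int[mu]_t ((v t - u n t) ^+ 2)%:E = \int[mu]_t ((v t - w n t) ^+ 2)%:E)%E.
    apply: ae_eq_integral => //.
    - exact/measurable_EFinP.
    - by apply/measurable_EFinP; apply: measurable_funX; exact: (measurable_funB mv (mw n)).
    - apply: (@filterS _ _ (ae_filter_ringOfSetsType mu) _ _ _ aeA) => t At _.
      by rewrite /w indicE mem_set// mulr1.
  have -> : (\int[mu]_t ((v t - w n t) ^+ 2)%:E =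
      \int[mu]_t limn_einf (fun m => ((w m t - w n t) ^+ 2)%:E))%E.
    apply: eq_integral => t _; apply/esym.
    suff h : ((w m t - w n t) ^+ 2)%:E @[m --> \oo] --> ((v t - w n t) ^+ 2)%:E.
      by rewrite (cvg_limn_einf_sup h).1.
    apply: cvg_EFin; first exact: nearW.
    rewrite !expr2; apply: cvgM; apply: cvgB; (try exact: cvg_cst); exact: cw.
  (* Fatou in m with n fixed; the lower limit is bounded by the tail m >= n, where the Cauchy bound
     holds. *)
  apply: (le_trans (fatou mu measurableT _ _)).
  - by move=> m; apply/measurable_EFinP; apply: measurable_funX; exact: (measurable_funB (mw m) (mw n)).
  - by move=> m t _; rewrite lee_fin sqr_ge0.
  apply: (@limn_einf_le _ _ n) => m nm.
  have [mni mnC] := Cu n m nm.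
  rewrite -lee_fin EFin_Rintegral// in mnC; apply: le_trans mnC.
  apply: ge0_le_integral => //.
  - by move=> t _; rewrite lee_fin sqr_ge0.
  - by apply/measurable_EFinP; apply: measurable_funX; exact: (measurable_funB (mw m) (mw n)).
  - by apply/measurable_EFinP; apply: measurable_funX; exact: (measurable_funB (mu_ m) (mu_ n)).
  - move=> t _; rewrite lee_fin /w -mulrBl exprMn ler_piMr ?sqr_ge0// indicE.
have vi : intg (fun t => (v t - u n t) ^+ 2).
  apply/integrableP; split; first exact/measurable_EFinP.
  under eq_integral do rewrite /= ger0_norm ?sqr_ge0//.
  by rewrite (le_lt_trans E)// ltry.
by split => //; rewrite -lee_fin EFin_Rintegral.
Qed.

End L2_completeness.

(** * Plancherel's identity *)

Section plancherel.
Context {R : realType}.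
Local Notation mu := (@lebesgue_measure R).
Local Notation intg f := (mu.-integrable setT (EFin \o f)).
Variable g : R.
Hypothesis g0 : g != 0.
Let kappa : R := 2 * pi / `|g|.

(** The integral of exp(i s t g) u(t) for real [u]. As one complex function, its [nsq] is the sum of
    squares in Plancherel's identity. *)
Definition cs (u : R -> R) (s : R) : R[i] := cosT g u s +i* sinT g u s.

Lemma L2_cs u : intg u -> intg (fun x => u x ^+ 2) ->
  L2 (cs u) /\ n2 (cs u) <= kappa * \int[mu]_x (u x ^+ 2).
Proof.
move=> ui u2i.
have mc : cmeasurable (cs u).
  by split; apply: continuous_measurable_fun; [exact: continuous_cosT|exact: continuous_sinT].
have b := bessel_cosT_sinT g0 ui u2i.
have ci : intg (fun s => nsq (cs u s)).
  apply/integrableP; split; first by apply/measurable_EFinP; exact: measurable_nsq.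
  under eq_integral do rewrite /= ger0_norm ?nsq_ge0//.
  by rewrite (le_lt_trans b)// ltry.
by split => //; rewrite -lee_fin EFin_Rintegral.
Qed.

Lemma csB u v s : intg u -> intg v -> cs (fun x => u x - v x) s = cs u s - cs v s.
Proof.
move=> ui vi; rewrite /cs /cosT /sinT; apply/eqP; rewrite eq_complex /=; apply/andP; split; apply/eqP.
- rewrite -RintegralB//; [|exact: integrable_cos_mul|exact: integrable_cos_mul].
  by apply: eq_Rintegral => t _; rewrite mulrBr.
- rewrite -RintegralB//; [|exact: integrable_sin_mul|exact: integrable_sin_mul].
  by apply: eq_Rintegral => t _; rewrite mulrBr.
Qed.

Lemma L2_real (u : R -> R) : measurable_fun [set: R] u -> intg (fun x => u x ^+ 2) ->
  L2 (fun x => (u x)%:C).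
Proof.
move=> m1 u2i; split; first by split=> //=; exact: measurable_cst.
by under eq_fun do rewrite /nsq /= expr0n addr0.
Qed.

Lemma n2_real (u : R -> R) : n2 (fun x => (u x)%:C) = \int[mu]_x (u x ^+ 2).
Proof. by apply: eq_Rintegral => x _; rewrite /nsq /= expr0n addr0. Qed.

(** Both sides are continuous in L2 along continuous approximants [v n]: the right by [n2_cvg], the
    left because the Bessel bound applies to u - v n. *)
Lemma plancherel_cs u : intg u -> intg (fun x => u x ^+ 2) ->
  n2 (cs u) = kappa * \int[mu]_x (u x ^+ 2).
Proof.
move=> ui u2i.
have m1 : measurable_fun [set: R] u by apply/measurable_EFinP; exact: measurable_int ui.
have e0 n : 0 < n.+1%:R^-1 :> R by rewrite invr_gt0.
have [v vP] := choice (fun n => continuous_dense (e0 n) ui u2i).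
have vi n : intg (v n) by have [M []] := vP n.
have uvi n : intg (fun x => (u x - v n x) ^+ 2) by have [M [_ _ _ []]] := vP n.
have uve n : \int[mu]_x ((u x - v n x) ^+ 2) < n.+1%:R^-1 by have [M [_ _ _ []]] := vP n.
have v2i n : intg (fun x => v n x ^+ 2).
  have [M [cv vM _ _]] := vP n; under eq_fun do rewrite expr2.
  by apply: (@integrable_bounded_mul _ _ _ M) => //; exact: continuous_measurable_fun.
have E n : n2 (cs (v n)) = kappa * \int[mu]_x (v n x ^+ 2).
  have [M [cv vM _ _]] := vP n; have [[_ ci] _] := L2_cs (vi n) (v2i n).
  apply: EFin_inj; rewrite EFin_Rintegral//.
  exact: (plancherel_cosT_sinT_continuous g0 cv vM).
have L n : L2 (fun x => (v n x)%:C).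
  by apply: L2_real => //; apply/measurable_EFinP; exact: measurable_int (vi n).
have h1 : n2 (fun x => (v n x)%:C - (u x)%:C) @[n --> \oo] --> 0.
  apply: (squeeze_cvgr _ (cvg_cst 0) cvg_harmonic).
  apply: nearW => n; rewrite n2_ge0/= n2_distC.
  have -> : n2 (fun x => (u x)%:C - (v n x)%:C) = \int[mu]_x ((u x - v n x) ^+ 2).
    by apply: eq_Rintegral => x _; rewrite /nsq /= subrr expr0n addr0.
  exact: ltW.
have h2 : n2 (fun s => cs (v n) s - cs u s) @[n --> \oo] --> 0.
  have h : kappa * (n.+1%:R^-1 : R) @[n --> \oo] --> 0.
    by rewrite -(mulr0 kappa); apply: cvgM; [exact: cvg_cst|exact: cvg_harmonic].
  apply: (squeeze_cvgr _ (cvg_cst 0) h).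
  apply: nearW => n; rewrite n2_ge0/= n2_distC.
  have -> : n2 (fun s => cs u s - cs (v n) s) = n2 (cs (fun x => u x - v n x)).
    by apply: eq_Rintegral => s _; rewrite csB.
  have [_] := L2_cs (integrableB_EFin ui (vi n)) (uvi n).
  move/le_trans; apply; rewrite ler_wpM2l ?ltW//.
  by rewrite /kappa divr_gt0// ?normr_gt0// mulr_gt0// pi_gt0.
have c1 := n2_cvg (L2_real m1 u2i) L h1.
have c2 := n2_cvg (L2_cs ui u2i).1 (fun n => (L2_cs (vi n) (v2i n)).1) h2.
rewrite n2_real in c1.
have c3 : n2 (cs (v n)) @[n --> \oo] --> kappa * \int[mu]_x (u x ^+ 2).
  under eq_fun do rewrite E -n2_real.
  by apply: cvgM; first exact: cvg_cst.
exact: cvg_unique c2 c3.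
Qed.

End plancherel.

(** * Linearity of the integral of complex-valued functions *)

Section complex_integral.
Context {R : realType}.
Local Notation mu := (@lebesgue_measure R).
Local Notation intg f := (mu.-integrable setT (EFin \o f)).
Implicit Types (f : R -> R[i]) (z w : R[i]).

Definition cintegrable f :=
  intg (fun t => complex.Re (f t)) /\ intg (fun t => complex.Im (f t)).

Lemma cintegrableD f1 f2 : cintegrable f1 -> cintegrable f2 ->
  cintegrable (fun t => f1 t + f2 t).
Proof.
move=> [a b] [c d]; split.
- have := integrableD_EFin a c; apply: eq_integrable => // t _ /=.
  by case: (f1 t) (f2 t) => [? ?] [? ?].
- have := integrableD_EFin b d; apply: eq_integrable => // t _ /=.
  by case: (f1 t) (f2 t) => [? ?] [? ?].
Qed.

Lemma cintegralD f1 f2 : cintegrable f1 -> cintegrable f2 ->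
  cintegral (fun t => f1 t + f2 t) = cintegral f1 + cintegral f2.
Proof.
move=> [a b] [c d]; rewrite /cintegral; apply/eqP; rewrite eq_complex /=.
by apply/andP; split; apply/eqP; rewrite -RintegralD//; apply: eq_Rintegral => t _;
  case: (f1 t) (f2 t) => [? ?] [? ?].
Qed.

Lemma cintegrableZ w f : cintegrable f -> cintegrable (fun t => w * f t).
Proof.
case: w => p q [a b]; split.
- have := integrableB_EFin (integrableZl_EFin p a) (integrableZl_EFin q b).
  by apply: eq_integrable => // t _ /=; case: (f t).
- have := integrableD_EFin (integrableZl_EFin p b) (integrableZl_EFin q a).
  by apply: eq_integrable => // t _ /=; case: (f t).
Qed.

Lemma cintegralZ w f : cintegrable f -> cintegral (fun t => w * f t) = w * cintegral f.
Proof.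
case: w => p q [a b]; rewrite /cintegral; apply/eqP; rewrite eq_complex /=.
apply/andP; split; apply/eqP; rewrite -!RintegralZl//.
- rewrite -RintegralB//; [|exact: integrableZl_EFin|exact: integrableZl_EFin].
  by apply: eq_Rintegral => t _; case: (f t).
- rewrite -RintegralD//; [|exact: integrableZl_EFin|exact: integrableZl_EFin].
  by apply: eq_Rintegral => t _; case: (f t).
Qed.

End complex_integral.

(** * The transform on L1 and L2 *)

Section transform_isometry.
Context {R : realType}.
Local Notation mu := (@lebesgue_measure R).
Local Notation intg f := (mu.-integrable setT (EFin \o f)).
Variables (alpha rho : R).
Hypothesis sin0 : sin alpha != 0.
Let z : R[i] := rho%:C * 'i%C.
Let a := cot alpha / 2.
Let g := csc alpha.
Let k : R := 4^-1 * (1 + rho ^+ 2).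
Implicit Types (f : R -> R[i]).

Let g0 : g != 0. Proof. by rewrite /g /csc invr_eq0. Qed.

Definition L12 f := cintegrable f /\ L2 f.

Definition chirp f (t : R) : R[i] := expi (a * t ^+ 2) * f t.

Lemma nsq_expi (x : R) : nsq (expi x) = 1.
Proof. by rewrite /nsq /expi /= cos2Dsin2. Qed.

Lemma cmeasurable_expi (c : R -> R) : measurable_fun [set: R] c -> cmeasurable (fun t => expi (c t)).
Proof.
move=> mc; split=> /=.
- by apply: (@measurableT_comp _ _ _ _ _ _ (@cos R)) => //; apply: continuous_measurable_fun; exact: continuous_cos.
- by apply: (@measurableT_comp _ _ _ _ _ _ (@sin R)) => //; apply: continuous_measurable_fun; exact: continuous_sin.
Qed.

Lemma cintegrable_phase_mul (c : R -> R) f : measurable_fun [set: R] c ->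
  cintegrable f -> cintegrable (fun t => expi (c t) * f t).
Proof.
move=> mc [f1 f2].
have [/= mcos msin] := cmeasurable_expi mc.
have i1 (w : R -> R) : intg w -> intg (fun t => cos (c t) * w t).
  by move=> wi; apply: (@integrable_bounded_mul _ _ _ 1) => // t; exact: norm_cos_le1.
have i2 (w : R -> R) : intg w -> intg (fun t => sin (c t) * w t).
  by move=> wi; apply: (@integrable_bounded_mul _ _ _ 1) => // t; exact: norm_sin_le1.
split.
- have := integrableB_EFin (i1 _ f1) (i2 _ f2).
  by apply: eq_integrable => // t _ /=; case: (f t).
- have := integrableD_EFin (i1 _ f2) (i2 _ f1).
  by apply: eq_integrable => // t _ /=; case: (f t).
Qed.

Lemma measurable_chirp_phase : measurable_fun [set: R] (fun t : R => a * t ^+ 2).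
Proof. by apply: measurable_funM => //; exact: measurable_funX. Qed.

Lemma cintegrable_chirp f : cintegrable f -> cintegrable (chirp f).
Proof. by apply: cintegrable_phase_mul; exact: measurable_chirp_phase. Qed.

Lemma nsq_chirp f t : nsq (chirp f t) = nsq (f t).
Proof. by rewrite /chirp nsqM nsq_expi mul1r. Qed.

Lemma L2_chirp f : L2 f -> L2 (chirp f).
Proof.
move=> [mf fi]; split; last by under eq_fun do rewrite nsq_chirp.
by apply: cmeasurableM => //; apply: cmeasurable_expi; exact: measurable_chirp_phase.
Qed.

Definition ccos f s : R[i] := cintegral (fun t => (cos (s * t * g))%:C * f t).
Definition csin f s : R[i] := cintegral (fun t => (sin (s * t * g))%:C * f t).

Lemma ccosE f s : ccos f s =
  cosT g (fun t => complex.Re (f t)) s +i* cosT g (fun t => complex.Im (f t)) s.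
Proof.
rewrite /ccos /cintegral /cosT; congr (_ +i* _); apply: eq_Rintegral => t _;
  by case: (f t) => x y /=; rewrite mul0r ?subr0 ?addr0.
Qed.

Lemma csinE f s : csin f s =
  sinT g (fun t => complex.Re (f t)) s +i* sinT g (fun t => complex.Im (f t)) s.
Proof.
rewrite /csin /cintegral /sinT; congr (_ +i* _); apply: eq_Rintegral => t _;
  by case: (f t) => x y /=; rewrite mul0r ?subr0 ?addr0.
Qed.

(** Comes from exp(- i x) + z exp(i x) = (1 + z) cos x - i (1 - z) sin x. *)
Definition cmix f s : R[i] := (1 + z) * ccos f s + (- 'i%C * (1 - z)) * csin f s.

Lemma O_L1E f s : cintegrable f ->
  O_L1 alpha z f s =
  c_coef alpha / (Num.sqrt (2 * pi))%:C * expi (a * s ^+ 2) * (2^-1 * cmix (chirp f) s).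
Proof.
move=> fi; rewrite /O_L1; congr (_ * _).
have hi := cintegrable_chirp fi.
have ic : cintegrable (fun t => (cos (s * t * g))%:C * chirp f t).
  case: hi => h1 h2; split.
  - have := integrable_cos_mul g s h1; apply: eq_integrable => // t _ /=.
    by case: (chirp f t) => x y /=; rewrite mul0r subr0.
  - have := integrable_cos_mul g s h2; apply: eq_integrable => // t _ /=.
    by case: (chirp f t) => x y /=; rewrite mul0r addr0.
have is_ : cintegrable (fun t => (sin (s * t * g))%:C * chirp f t).
  case: hi => h1 h2; split.
  - have := integrable_sin_mul g s h1; apply: eq_integrable => // t _ /=.
    by case: (chirp f t) => x y /=; rewrite mul0r subr0.
  - have := integrable_sin_mul g s h2; apply: eq_integrable => // t _ /=.
    by case: (chirp f t) => x y /=; rewrite mul0r addr0.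
rewrite /cmix /ccos /csin -!cintegralZ// -cintegralD; try exact: cintegrableZ.
rewrite -cintegralZ; last by apply: cintegrableD; exact: cintegrableZ.
congr (cintegral _); apply/funext => t.
rewrite -/a -/g /chirp.
have -> : expi (- (s * t * g)) = (cos (s * t * g))%:C - 'i%C * (sin (s * t * g))%:C.
  by rewrite /expi cosN sinN; apply/eqP; rewrite eq_complex /=; apply/andP; split; apply/eqP; ring.
have -> : expi (s * t * g) = (cos (s * t * g))%:C + 'i%C * (sin (s * t * g))%:C.
  by rewrite /expi; apply/eqP; rewrite eq_complex /=; apply/andP; split; apply/eqP; ring.
by ring.
Qed.

(** The kernels are real, so the real and imaginary parts of [f] are transformed separately;
    regrouping the four squares reduces the claim to Plancherel for each part. *)
Lemma L2_ccos_csin f : L12 f ->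
  [/\ L2 (ccos f), L2 (csin f) & n2 (ccos f) + n2 (csin f) = 2 * pi / `|g| * n2 f].
Proof.
move=> [[f1 f2] [[m1 m2] fi]].
have f1i : intg (fun t => complex.Re (f t) ^+ 2).
  apply: le_integrable_EFin fi; first exact: measurable_funX.
  by move=> t; rewrite ger0_norm ?sqr_ge0// /nsq lerDl sqr_ge0.
have f2i : intg (fun t => complex.Im (f t) ^+ 2).
  apply: le_integrable_EFin fi; first exact: measurable_funX.
  by move=> t; rewrite ger0_norm ?sqr_ge0// /nsq lerDr sqr_ge0.
have [[mc1 c1] _] := L2_cs g0 f1 f1i.
have [[mc2 c2] _] := L2_cs g0 f2 f2i.
have cc := integrableD_EFin c1 c2.
have mC : cmeasurable (ccos f).
  have -> : ccos f = fun s => cosT g (fun t => complex.Re (f t)) s +i* cosT g (fun t => complex.Im (f t)) s.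
    by apply/funext => s; exact: ccosE.
  by split=> /=; [exact: mc1.1|exact: mc2.1].
have mS : cmeasurable (csin f).
  have -> : csin f = fun s => sinT g (fun t => complex.Re (f t)) s +i* sinT g (fun t => complex.Im (f t)) s.
    by apply/funext => s; exact: csinE.
  by split=> /=; [exact: mc1.2|exact: mc2.2].
have E s : nsq (ccos f s) + nsq (csin f s) =
    nsq (cs g (fun t => complex.Re (f t)) s) + nsq (cs g (fun t => complex.Im (f t)) s).
  by rewrite ccosE csinE /nsq /cs /=; ring.
have iC : intg (fun s => nsq (ccos f s)).
  apply: le_integrable_EFin cc; first exact: measurable_nsq.
  by move=> s; rewrite ger0_norm ?nsq_ge0// -E lerDl nsq_ge0.
have iS : intg (fun s => nsq (csin f s)).
  apply: le_integrable_EFin cc; first exact: measurable_nsq.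
  by move=> s; rewrite ger0_norm ?nsq_ge0// -E lerDr nsq_ge0.
split => //.
rewrite /n2 -RintegralD//.
transitivity (\int[mu]_s (nsq (cs g (fun t => complex.Re (f t)) s) + nsq (cs g (fun t => complex.Im (f t)) s))).
  by apply: eq_Rintegral => s _; exact: E.
rewrite RintegralD// [X in X + _](plancherel_cs g0 f1 f1i) [X in _ + X](plancherel_cs g0 f2 f2i).
by rewrite -mulrDr -RintegralD.
Qed.

Lemma n2_opp f : cmeasurable f -> n2 (fun s => f (- s)) = n2 f.
Proof.
move=> mf; rewrite /n2 /Rintegral; congr fine.
apply: (ge0_integral_opp (f := fun s => (nsq (f s))%:E)).
- by apply/measurable_EFinP; exact: measurable_nsq.
- by move=> s; rewrite lee_fin nsq_ge0.
Qed.

(* s -> -s flips the sign of the sine part, so the cross terms cancel by the parallelogram law *)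
Lemma n2_cmix f : L12 f -> L2 (cmix f) /\
  n2 (cmix f) = (1 + rho ^+ 2) * (2 * pi / `|g|) * n2 f.
Proof.
move=> Lf; have [LC LS E] := L2_ccos_csin Lf.
have LW : L2 (cmix f) by apply: L2D; exact: L2Z.
split => //.
have No s : cmix f (- s) = (1 + z) * ccos f s - (- 'i%C * (1 - z)) * csin f s.
  rewrite /cmix (_ : ccos f (- s) = ccos f s); last first.
    by rewrite /ccos; congr cintegral; apply/funext => t; rewrite !mulNr cosN.
  rewrite (_ : csin f (- s) = - csin f s); last first.
    rewrite !csinE /sinT; apply/eqP; rewrite eq_complex /=; apply/andP; split; apply/eqP;
      rewrite -mulN1r -RintegralZl//; try (by apply: integrable_sin_mul; case: Lf => -[]);
      by apply: eq_Rintegral => t _; rewrite !mulNr sinN; ring.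
  by ring.
have h : n2 (cmix f) + n2 (fun s => cmix f (- s)) =
    2 * ((1 + rho ^+ 2) * (n2 (ccos f) + n2 (csin f))).
  have Lo : L2 (fun s => cmix f (- s)).
    have -> : (fun s => cmix f (- s)) = (fun s => (1 + z) * ccos f s - (- 'i%C * (1 - z)) * csin f s).
      by apply/funext => s; exact: No.
    by apply: L2B; exact: L2Z.
  case: LC LS LW Lo => [_ iC] [_ iS] [_ iW] [_ iO].
  rewrite /n2 -!RintegralD// -!RintegralZl//; last 2 first.
  - by apply: integrableZl_EFin; exact: integrableD_EFin.
  - exact: integrableD_EFin.
  apply: eq_Rintegral => s _; rewrite No /cmix /z.
  by case: (ccos f s) (csin f s) => [p q] [p' q']; rewrite /nsq /=; ring.
move: h; rewrite n2_opp; last by case: LW.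
rewrite E => h; apply: (@mulfI _ 2); first by rewrite pnatr_eq0.
by rewrite mulr_natl mulr2n h -!mulrA.
Qed.

Lemma nsqV (w : R[i]) : nsq w^-1 = (nsq w)^-1.
Proof.
have [->|w0] := eqVneq w 0; first by rewrite invr0 /nsq /= expr0n addr0 invr0.
have nw : nsq w != 0.
  rewrite -sqr_normc_nsq sqrf_eq0; apply: contra w0 => /eqP h.
  by apply/eqP; exact: Normc.eq0_normc.
by apply: (mulIf nw); rewrite -nsqM !mulVf// /nsq /= expr1n expr0n addr0.
Qed.

(** Squaring removes the root: |1 - i cot|^2 = 1 + cot^2 = csc^2. Nonnegativity of [nsq] then
    selects the sign. *)
Lemma nsq_c_coef : nsq (c_coef alpha) = `|g|.
Proof.
have : nsq (c_coef alpha) ^+ 2 = g ^+ 2.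
  rewrite expr2 -nsqM -expr2 /c_coef sqr_sqrtc /nsq /= /g /csc /cot.
  have := cos2Dsin2 alpha => h.
  transitivity ((cos alpha ^+ 2 + sin alpha ^+ 2) / sin alpha ^+ 2); first by field.
  by rewrite h mul1r exprVn.
move=> /eqP; rewrite eqf_sqr => /orP[] /eqP h.
- by rewrite -h ger0_norm// nsq_ge0.
- by rewrite -[g]opprK -h normrN ger0_norm// nsq_ge0.
Qed.

Lemma n2_O_L1 f : L12 f -> L2 (O_L1 alpha z f) /\ n2 (O_L1 alpha z f) = k * n2 f.
Proof.
move=> [fi Lf].
have Lh : L12 (chirp f) by split; [exact: cintegrable_chirp|exact: L2_chirp].
have [LW EW] := n2_cmix Lh.
have -> : O_L1 alpha z f = fun s =>
    expi (a * s ^+ 2) * ((c_coef alpha / (Num.sqrt (2 * pi))%:C * 2^-1) * cmix (chirp f) s).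
  by apply/funext => s; rewrite O_L1E//; ring.
set c := _ / _ * _.
have Lc := L2Z c LW.
split.
  have [mc ic] := Lc; split; last by under eq_fun do rewrite nsqM nsq_expi mul1r.
  by apply: cmeasurableM => //; apply: cmeasurable_expi; exact: measurable_chirp_phase.
transitivity (n2 (fun s => c * cmix (chirp f) s)).
  by apply: eq_Rintegral => s _; rewrite nsqM nsq_expi mul1r.
rewrite n2Z// EW.
have -> : n2 (chirp f) = n2 f by apply: eq_Rintegral => t _; rewrite nsq_chirp.
have p0 : 0 < (2 : R) * pi by rewrite mulr_gt0// pi_gt0.
(* The factors are |g| from [c_coef], 1 / (2 pi) from the normalisation and 1 / 4 from the halved
   kernel. Against 2 pi / |g| from Plancherel, only 1 / 4 remains. *)
have -> : nsq c = `|g| / (8 * pi).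
  rewrite /c !nsqM nsq_c_coef.
  rewrite !nsqV (_ : nsq (Num.sqrt (2 * pi))%:C = 2 * pi); last first.
    by rewrite /nsq /= expr0n addr0 sqr_sqrtr// ltW.
  rewrite (_ : nsq (2 : R[i]) = 4); last by rewrite -[2]/(1 + 1) /nsq /=; ring.
  by move: {p0} (pi : R) (lt0r_neq0 (pi_gt0 R)) => p pn; field.
move: {p0} (pi : R) (lt0r_neq0 (pi_gt0 R)) => p pn.
by rewrite /k; field; rewrite normr_eq0 g0.
Qed.

Lemma O_L1_linear f1 f2 w s : cintegrable f1 -> cintegrable f2 ->
  O_L1 alpha z (fun t => f1 t + w * f2 t) s = O_L1 alpha z f1 s + w * O_L1 alpha z f2 s.
Proof.
move=> i1 i2.
rewrite !O_L1E//; last by apply: cintegrableD => //; exact: cintegrableZ.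
have ik (c : R -> R) f : measurable_fun [set: R] c -> (forall t, `|c t| <= 1) ->
    cintegrable f -> cintegrable (fun t => (c t)%:C * chirp f t).
  move=> mc c1 /cintegrable_chirp [h1 h2]; split.
  - have := integrable_bounded_mul mc c1 h1; apply: eq_integrable => // t _ /=.
    by case: (chirp f t) => x y /=; rewrite mul0r subr0.
  - have := integrable_bounded_mul mc c1 h2; apply: eq_integrable => // t _ /=.
    by case: (chirp f t) => x y /=; rewrite mul0r addr0.
have lin (c : R -> R) : measurable_fun [set: R] c -> (forall t, `|c t| <= 1) ->
   cintegral (fun t => (c t)%:C * chirp (fun t => f1 t + w * f2 t) t) =
   cintegral (fun t => (c t)%:C * chirp f1 t) + w * cintegral (fun t => (c t)%:C * chirp f2 t).
  move=> mc c1; have j1 := ik _ _ mc c1 i1; have j2 := ik _ _ mc c1 i2.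
  rewrite -cintegralZ// -cintegralD//; last exact: cintegrableZ.
  by congr cintegral; apply/funext => t; rewrite /chirp; ring.
have lc : ccos (chirp (fun t => f1 t + w * f2 t)) s = ccos (chirp f1) s + w * ccos (chirp f2) s.
  by apply: lin; [exact: measurable_cos_phase|move=> t; exact: norm_cos_le1].
have ls : csin (chirp (fun t => f1 t + w * f2 t)) s = csin (chirp f1) s + w * csin (chirp f2) s.
  by apply: lin; [exact: measurable_sin_phase|move=> t; exact: norm_sin_le1].
by rewrite /cmix lc ls; ring.
Qed.

End transform_isometry.

(** * Extension to L2 *)

Section L2_extension.
Context {R : realType}.
Local Notation mu := (@lebesgue_measure R).
Local Notation intg f := (mu.-integrable setT (EFin \o f)).
Implicit Types (f : R -> R[i]).

Lemma L2_complete (F : nat -> R -> R[i]) (C : R) : (forall n, L2 (F n)) ->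
  (forall n m, (n <= m)%N -> n2 (fun t => F m t - F n t) <= C * (4^-1) ^+ n) ->
  exists2 G, L2 G & n2 (fun t => F n t - G t) @[n --> \oo] --> 0.
Proof.
move=> LF FC.
(* Stated for an additive [p] dominated by the modulus, so as to serve for both real and imaginary
   parts. *)
have comp (p : R[i] -> R) : (forall z w, p (z - w) = p z - p w) ->
    (forall z, p z ^+ 2 <= nsq z) -> (forall n, measurable_fun [set: R] (fun t => p (F n t))) ->
    exists2 v : R -> R, measurable_fun [set: R] v &
    forall n, intg (fun t => (v t - p (F n t)) ^+ 2) /\
      \int[mu]_t ((v t - p (F n t)) ^+ 2) <= C * (4^-1) ^+ n.
  move=> pB pn mp; apply: (@L2_complete_real _ (fun n t => p (F n t))) => // n m nm.
  have [_ iB] := L2B (LF m) (LF n).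
  have i : intg (fun t => (p (F m t) - p (F n t)) ^+ 2).
    apply: le_integrable_EFin iB; first by apply: measurable_funX; exact: measurable_funB.
    by move=> t; rewrite ger0_norm ?sqr_ge0// -pB.
  split => //; apply: le_trans (FC n m nm); apply: le_Rintegral => // t _.
  by rewrite -pB.
have [v1 mv1 v1P] : exists2 v : R -> R, measurable_fun [set: R] v &
    forall n, intg (fun t => (v t - complex.Re (F n t)) ^+ 2) /\
      \int[mu]_t ((v t - complex.Re (F n t)) ^+ 2) <= C * (4^-1) ^+ n.
  apply: comp => [[a b] [c d] //|[a b]|n]; first by rewrite /nsq lerDl sqr_ge0.
  by case: (LF n) => -[].
have [v2 mv2 v2P] : exists2 v : R -> R, measurable_fun [set: R] v &
    forall n, intg (fun t => (v t - complex.Im (F n t)) ^+ 2) /\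
      \int[mu]_t ((v t - complex.Im (F n t)) ^+ 2) <= C * (4^-1) ^+ n.
  apply: comp => [[a b] [c d] //|[a b]|n]; first by rewrite /nsq lerDr sqr_ge0.
  by case: (LF n) => -[].
pose G t := v1 t +i* v2 t.
have E n t : nsq (G t - F n t) = (v1 t - complex.Re (F n t)) ^+ 2 + (v2 t - complex.Im (F n t)) ^+ 2.
  by rewrite /G; case: (F n t).
have LGF n : L2 (fun t => G t - F n t).
  split; last first.
    under eq_fun do rewrite E.
    by apply: integrableD_EFin; [exact: (v1P n).1|exact: (v2P n).1].
  have [mF _] := L2Z (-1) (LF n).
  have mG : cmeasurable G by [].
  by have := cmeasurableD mG mF; under eq_fun do rewrite mulN1r.
have LG : L2 G.
  by have := L2D (LGF 0%N) (LF 0%N); under eq_fun do rewrite subrK.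
exists G => //.
have h : 2 * C * (4^-1) ^+ n @[n --> \oo] --> (0 : R).
  rewrite -(mulr0 (2 * C)); apply: cvgM; first exact: cvg_cst.
  by apply: cvg_expr; rewrite ger0_norm; lra.
apply: (squeeze_cvgr _ (cvg_cst 0) h).
apply: nearW => n; rewrite n2_ge0/= n2_distC /n2.
have [i1 h1] := v1P n; have [i2 h2] := v2P n.
have -> : \int[mu]_t nsq (G t - F n t) = \int[mu]_t ((v1 t - complex.Re (F n t)) ^+ 2 + (v2 t - complex.Im (F n t)) ^+ 2).
  by apply: eq_Rintegral => t _; exact: E.
by rewrite RintegralD//; lra.
Qed.

(** The restrictions of [f] to [-n, n] converge by domination, and they are integrable because |p|
    <= 1 + p^2 on a set of finite measure. *)
Lemma L12_dense f (e : R) : 0 < e -> L2 f ->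
  exists2 h, L12 h & n2 (fun t => h t - f t) < e.
Proof.
move=> e0 Lf; have [[m1 m2] fi] := Lf.
pose A n := `[- n%:R, n%:R]%classic : set R.
have mA n : measurable (A n) by exact: measurable_itv.
pose F n t : R[i] := (\1_(A n) t)%:C * f t.
have mF n : cmeasurable (F n).
  by apply: cmeasurableM => //; split => //=; exact: measurable_indic.
have nF n t : nsq (F n t) <= nsq (f t).
  rewrite /F nsqM ler_piMl ?nsq_ge0// /nsq /= expr0n addr0 indicE.
  by case: (_ \in _); rewrite ?expr1n ?expr0n.
have LF n : L2 (F n).
  split => //; apply: le_integrable_EFin fi; first exact: measurable_nsq.
  by move=> t; rewrite ger0_norm ?nsq_ge0.
have i1 n (p : R -> R) : measurable_fun [set: R] p -> (forall t, p t ^+ 2 <= nsq (f t)) ->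
    intg (fun t => \1_(A n) t * p t).
  move=> mp pf.
  have iA : intg (\1_(A n) : R -> R) by exact: integrable_indic_itv.
  apply: le_integrable_EFin (integrableD_EFin iA fi).
    by apply: measurable_funM => //; exact: measurable_indic.
  move=> t; have := pf t; rewrite indicE; case: (_ \in _); last first.
    by rewrite mul0r normr0 add0r => _; exact: nsq_ge0.
  rewrite mul1r -[(true%:R : R)]/(1 : R) -(real_normK (num_real (p t))) => h.
  by have := sqr_ge0 (`|p t| - 1); nra.
have CF n : cintegrable (F n).
  split.
  - have := i1 n _ m1 (fun t => _); have h t : complex.Re (f t) ^+ 2 <= nsq (f t) by rewrite lerDl sqr_ge0.
    move=> /(_ h); apply: eq_integrable => // t _ /=.
    by rewrite /F; case: (f t) => x y /=; rewrite mul0r subr0.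
  - have := i1 n _ m2 (fun t => _); have h t : complex.Im (f t) ^+ 2 <= nsq (f t) by rewrite lerDr sqr_ge0.
    move=> /(_ h); apply: eq_integrable => // t _ /=.
    by rewrite /F; case: (f t) => x y /=; rewrite mul0r addr0.
have cF : n2 (fun t => F n t - f t) @[n --> \oo] --> 0.
  have := @dominated_Rintegral_cvg _ (fun n t => nsq (F n t - f t)) (cst 0) (fun t => nsq (f t)).
  rewrite [X in _ --> X]Rintegral_cst//= mul0r; apply => //.
  - by move=> n; apply: measurable_nsq; case: (L2B (LF n) Lf).
  - move=> t; apply: cvg_near_cst; near=> n.
    have tn : `|t| <= n%:R by near: n; exact: nbhs_infty_ger.
    rewrite /F indicE mem_set ?mul1r ?subrr; first by rewrite /nsq /= expr0n addr0.
    by rewrite /A /= in_itv/= -ler_norml.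
  - move=> n t; rewrite ger0_norm ?nsq_ge0// /F indicE; case: (_ \in _).
      by rewrite mul1r subrr {1}/nsq /= expr0n addr0 nsq_ge0.
    by rewrite mul0r sub0r nsqN.
have /cvgrPdist_lt/(_ _ e0)[n _ /(_ n (leqnn n))] := cF.
rewrite sub0r normrN ger0_norm ?n2_ge0// => h.
by exists (F n).
Unshelve. all: end_near. Qed.

(** The rate 4^-n is the one that feeds the geometric Cauchy condition of [L2_complete]. *)
Lemma L12_seq f : L2 f -> exists F : nat -> R -> R[i],
  [/\ forall n, L12 (F n), forall n, n2 (fun t => F n t - f t) <= (4^-1) ^+ n &
    n2 (fun t => F n t - f t) @[n --> \oo] --> 0].
Proof.
move=> Lf.
have e0 n : 0 < (4^-1 : R) ^+ n by rewrite exprn_gt0.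
have [F FP] := choice (fun n => let: ex_intro2 h a b := L12_dense (e0 n) Lf in ex_intro _ h (conj a b)).
exists F; split => [n|n|]; [exact: (FP n).1|exact: ltW (FP n).2|].
have h : (4^-1 : R) ^+ n @[n --> \oo] --> (0 : R) by apply: cvg_expr; rewrite ger0_norm; lra.
apply: (squeeze_cvgr _ (cvg_cst 0) h).
by apply: nearW => n; rewrite n2_ge0/= ltW// (FP n).2.
Qed.

Lemma L12_lin f1 f2 w : L12 f1 -> L12 f2 -> L12 (fun t => f1 t + w * f2 t).
Proof.
move=> [i1 l1] [i2 l2]; split; first by apply: cintegrableD => //; exact: cintegrableZ.
by apply: L2D => //; exact: L2Z.
Qed.

Lemma L12B f1 f2 : L12 f1 -> L12 f2 -> L12 (fun t => f1 t - f2 t).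
Proof.
by move=> l1 l2; have := L12_lin (-1) l1 l2; under eq_fun do rewrite mulN1r.
Qed.

(** * Limits of the transform along approximants, and its extensions *)

Section with_parameters.
Variables (alpha rho : R).
Hypothesis sin0 : sin alpha != 0.
Let z : R[i] := rho%:C * 'i%C.
Let k : R := 4^-1 * (1 + rho ^+ 2).
Local Notation O := (O_L1 alpha z).

Let k0 : 0 <= k.
Proof. by rewrite /k mulr_ge0// addr_ge0 ?sqr_ge0. Qed.

Let k1 : 0 < 1 + k.
Proof. by rewrite ltr_wpDr. Qed.

Let k_le : k <= (1 + k) ^+ 2.
Proof. by move: k k0 => x x0; nra. Qed.

Lemma n2_O_L1B f1 f2 : L12 f1 -> L12 f2 ->
  n2 (fun s => O f1 s - O f2 s) = k * n2 (fun t => f1 t - f2 t).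
Proof.
move=> l1 l2; rewrite -(n2_O_L1 rho sin0 (L12B l1 l2)).2.
apply: eq_Rintegral => s _; congr nsq.
have := O_L1_linear alpha rho (-1) s l1.1 l2.1.
rewrite mulN1r => <-; congr (O_L1 _ _ _ s); apply/funext => t; by rewrite mulN1r.
Qed.

(** Describes the value of an extension at [f] by its distances to all transforms of L1 and L2
    functions, without reference to an approximating sequence. *)
Definition is_limit_O f G := L2 G /\
  forall h, L12 h -> n2 (fun s => O h s - G s) = k * n2 (fun t => h t - f t).

Lemma n2_cvg_sub (F : nat -> R -> R[i]) f h : L2 f -> L2 h -> (forall n, L2 (F n)) ->
  n2 (fun t => F n t - f t) @[n --> \oo] --> 0 ->
  n2 (fun t => h t - F n t) @[n --> \oo] --> n2 (fun t => h t - f t).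
Proof.
move=> Lf Lh LF cF; apply: n2_cvg; first exact: L2B.
  by move=> n; exact: L2B.
under eq_fun do rewrite n2_distC.
under eq_fun => n.
  rewrite (_ : (fun t => _) = (fun t => F n t - f t)).
    over.
  by apply/funext => t; ring.
exact: cF.
Qed.

Lemma exists_limit_O f : L2 f -> exists G, is_limit_O f G.
Proof.
move=> Lf; have [F [LF Fe Fc]] := L12_seq Lf.
have LOF n : L2 (O (F n)) by exact: (n2_O_L1 rho sin0 (LF n)).1.
have [G LG Gc] : exists2 G, L2 G & n2 (fun t => O (F n) t - G t) @[n --> \oo] --> 0.
  (* For n <= m, the squared distance from [F m] to [F n] is at most 2 (4^-m) + 2 (4^-n) <= 4
     (4^-n), and the transform multiplies it by [k]. *)
  apply: (@L2_complete _ (4 * k)) => // n m nm.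
  rewrite n2_O_L1B// -[leRHS]mulrA [leRHS]mulrCA ler_wpM2l//.
  have := n2D_le (L2B (LF m).2 Lf) (L2B Lf (LF n).2).
  under eq_fun do rewrite addrA subrK.
  rewrite [X in _ <= _ + 2 * X]n2_distC.
  have := Fe n; have := Fe m.
  have : (4^-1 : R) ^+ m <= 4^-1 ^+ n by rewrite ler_wiXn2l//; lra.
  by lra.
exists G; split => // h Lh.
have LOh : L2 (O h) by exact: (n2_O_L1 rho sin0 Lh).1.
have c1 := n2_cvg_sub LG LOh LOF Gc.
have c2 := n2_cvg_sub Lf Lh.2 (fun n => (LF n).2) Fc.
have c3 : n2 (fun s => O h s - O (F n) s) @[n --> \oo] --> k * n2 (fun t => h t - f t).
  under eq_fun do rewrite n2_O_L1B//.
  by apply: cvgM; first exact: cvg_cst.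
exact: cvg_unique c1 c3.
Qed.

Lemma is_limit_O_L1 f : L12 f -> is_limit_O f (O f).
Proof.
move=> Lf; split; first exact: (n2_O_L1 rho sin0 Lf).1.
by move=> h Lh; exact: n2_O_L1B.
Qed.

(** It suffices to approximate [f2]: the distance from [G1] to each transformed approximant is known
    exactly from the defining property of [G1]. *)
Lemma is_limit_O_isometry f1 f2 G1 G2 : L2 f1 -> L2 f2 ->
  is_limit_O f1 G1 -> is_limit_O f2 G2 ->
  n2 (fun s => G1 s - G2 s) = k * n2 (fun t => f1 t - f2 t).
Proof.
move=> Lf1 Lf2 [LG1 h1] [LG2 h2].
have [F [LF Fe Fc]] := L12_seq Lf2.
have LOF n : L2 (O (F n)) by exact: (n2_O_L1 rho sin0 (LF n)).1.
have Oc : n2 (fun s => O (F n) s - G2 s) @[n --> \oo] --> 0.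
  under eq_fun do rewrite h2//.
  by rewrite -(mulr0 k); apply: cvgM; first exact: cvg_cst.
have c1 := n2_cvg_sub LG2 LG1 LOF Oc.
have c2 := n2_cvg_sub Lf2 Lf1 (fun n => (LF n).2) Fc.
have c3 : n2 (fun s => G1 s - O (F n) s) @[n --> \oo] --> k * n2 (fun t => f1 t - f2 t).
  under eq_fun do rewrite n2_distC h1// n2_distC.
  by apply: cvgM; first exact: cvg_cst.
exact: cvg_unique c1 c3.
Qed.

Lemma cLnorm2_lt f (e : R) : 0 < e -> L2 f -> (cLnorm 2%:E f < e%:E)%E = (n2 f < e ^+ 2).
Proof.
move=> e0 Lf; rewrite cLnorm2E// lte_fin.
by rewrite -[in LHS](ger0_norm (ltW e0)) -sqrtr_sqr ltr_sqrt// exprn_gt0.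
Qed.

Lemma exists_L2_extension : exists T, is_L2_extension alpha z T.
Proof.
(* Values are chosen function by function. Forcing G = O f on [L12] gives agreement with the
   integral formula at every point; outside [L2] the value is arbitrary. *)
have ex f : exists G, L2 f -> is_limit_O f G /\ (L12 f -> G = O f).
  have [Lf|nLf] := pselect (L2 f); last by exists f.
  have [lf|nlf] := pselect (L12 f).
    by exists (O f) => _; split => //; exact: is_limit_O_L1.
  by have [G hG] := exists_limit_O Lf; exists G.
have [T TP] := choice ex.
have LT f : L2 f -> L2 (T f) by move=> Lf; case: (TP f Lf) => -[].
exists T; split.
- by move=> f /in_L2P Lf; apply/in_L2P; exact: LT.
- move=> f /in_L2P Lf e e0.
  (* Distances scale by the square root of [k], which [k_le] bounds by 1 + k. *)
  exists (e / (1 + k)); first by rewrite divr_gt0.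
  move=> h /in_L2P Lh.
  rewrite cLnorm2_lt ?divr_gt0//; last exact: L2B.
  rewrite cLnorm2_lt//; last by apply: L2B; exact: LT.
  rewrite (is_limit_O_isometry Lh Lf (TP h Lh).1 (TP f Lf).1) => hd.
  rewrite (@le_lt_trans _ _ ((1 + k) ^+ 2 * n2 (fun t => h t - f t)))//.
    by rewrite ler_wpM2r ?n2_ge0.
  by move: hd; rewrite expr_div_n ltr_pdivlMr ?exprn_gt0// mulrC.
- move=> f /in_L1P lf /in_L2P Lf; apply: aeW => s.
  by rewrite ((TP f Lf).2 (conj lf Lf)).
Qed.

(** Continuity of [T] is used at [f1] and at [f2] separately, so the combination T f1 + w T f2 is
    reached without linearity of [T]. *)
Lemma L2_extension_isometry T f1 f2 w : is_L2_extension alpha z T -> L2 f1 -> L2 f2 ->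
  n2 (fun s => T f1 s + w * T f2 s) = k * n2 (fun t => f1 t + w * f2 t).
Proof.
move=> [T2 Tc TO] Lf1 Lf2.
have LT f : L2 f -> L2 (T f) by move=> /in_L2P /T2 /in_L2P.
have cT f (F : nat -> R -> R[i]) : L2 f -> (forall n, L2 (F n)) ->
    n2 (fun t => F n t - f t) @[n --> \oo] --> 0 ->
    n2 (fun s => T (F n) s - T f s) @[n --> \oo] --> 0.
  move=> Lf LF Fc; apply/cvgrPdist_lt => e e0.
  (* Continuity of [T] is stated for norms, convergence here for squared norms. *)
  have q0 : 0 < Num.sqrt e by rewrite sqrtr_gt0.
  have [d d0 hd] := Tc f ((in_L2P f).2 Lf) _ q0.
  have d20 : 0 < d ^+ 2 by rewrite exprn_gt0.
  near=> n.
  rewrite sub0r normrN ger0_norm ?n2_ge0//.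
  have := hd (F n) ((in_L2P _).2 (LF n)).
  rewrite cLnorm2_lt//; last exact: L2B.
  rewrite cLnorm2_lt//; last by apply: L2B; exact: LT.
  rewrite sqr_sqrtr ?(ltW e0)//; apply.
  by near: n; exact: (cvgr_lt 0).
have [F [LF _ Fc]] := L12_seq Lf1.
have [H [LH _ Hc]] := L12_seq Lf2.
have comb (f1' f2' : R -> R[i]) (F' H' : nat -> R -> R[i]) : L2 f1' -> L2 f2' ->
    (forall n, L2 (F' n)) -> (forall n, L2 (H' n)) ->
    n2 (fun t => F' n t - f1' t) @[n --> \oo] --> 0 ->
    n2 (fun t => H' n t - f2' t) @[n --> \oo] --> 0 ->
    n2 (fun t => F' n t + w * H' n t) @[n --> \oo] --> n2 (fun t => f1' t + w * f2' t).
  move=> l1 l2 lF lH cF cH; apply: n2_cvg.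
  - by apply: L2D => //; exact: L2Z.
  - by move=> n; apply: L2D => //; exact: L2Z.
  have h : 2 * n2 (fun t => F' n t - f1' t) + 2 * (nsq w * n2 (fun t => H' n t - f2' t)) @[n --> \oo] --> (0 : R).
    have -> : (0 : R) = 2 * 0 + 2 * (nsq w * 0) by rewrite !mulr0 addr0.
    apply: cvgD; first by apply: cvgM; first exact: cvg_cst.
    by apply: cvgM; [exact: cvg_cst|apply: cvgM; first exact: cvg_cst].
  apply: (squeeze_cvgr _ (cvg_cst 0) h).
  apply: nearW => n; rewrite n2_ge0/=.
  have := n2D_le (L2B (lF n) l1) (L2Z w (L2B (lH n) l2)).
  rewrite n2Z; last exact: L2B.
  apply: le_trans; rewrite le_eqVlt; apply/orP; left; apply/eqP.
  by congr n2; apply/funext => t; ring.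
have c1 := comb _ _ _ _ (LT _ Lf1) (LT _ Lf2) (fun n => LT _ (LF n).2) (fun n => LT _ (LH n).2)
  (cT _ _ Lf1 (fun n => (LF n).2) Fc) (cT _ _ Lf2 (fun n => (LH n).2) Hc).
have c2 := comb _ _ _ _ Lf1 Lf2 (fun n => (LF n).2) (fun n => (LH n).2) Fc Hc.
(* On approximants [T] equals the integral formula almost everywhere; that formula is linear, so its
   isometry applies to the single function F n + w H n. *)
have E n : n2 (fun s => T (F n) s + w * T (H n) s) = k * n2 (fun t => F n t + w * H n t).
  rewrite -(n2_O_L1 rho sin0 (L12_lin w (LF n) (LH n))).2.
  apply: n2_ae_eq.
  - by case: (L2D (LT _ (LF n).2) (L2Z w (LT _ (LH n).2))).
  - by case: (n2_O_L1 rho sin0 (L12_lin w (LF n) (LH n))) => -[].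
  have a1 := TO _ ((in_L1P _).2 (LF n).1) ((in_L2P _).2 (LF n).2).
  have a2 := TO _ ((in_L1P _).2 (LH n).1) ((in_L2P _).2 (LH n).2).
  apply: (@filterS2 _ _ (ae_filter_ringOfSetsType mu) _ _ _ _ a1 a2) => s -> ->.
  by rewrite (O_L1_linear alpha rho w s (LF n).1 (LH n).1).
have c3 : n2 (fun s => T (F n) s + w * T (H n) s) @[n --> \oo] --> k * n2 (fun t => f1 t + w * f2 t).
  under eq_fun do rewrite E.
  by apply: cvgM; first exact: cvg_cst.
exact: cvg_unique c1 c3.
Unshelve. all: end_near. Qed.

End with_parameters.
End L2_extension.

(** * Zeros of the sine *)

Lemma sin_mulrz_pi (R : realType) (k : int) : sin (k%:~R * pi) = 0 :> R.
Proof.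
have nat_case (n : nat) : sin (n%:R * pi) = 0 :> R.
  by elim: n => [|n IH]; rewrite ?mul0r ?sin0// mulrSr mulrDl mul1r sinDpi IH oppr0.
case: k => n; first exact: nat_case.
by rewrite NegzE mulrNz mulNr sinN -pmulrn nat_case oppr0.
Qed.

(** If sin alpha = 0, subtracting the multiple of pi given by the floor of alpha / pi leaves a zero
    of sin in [0, pi); positivity of sin on the open interval forces it to be 0. *)
Lemma sin_neq0 (R : realType) (alpha : R) :
  (~ exists k : int, alpha = k%:~R * pi) -> sin alpha != 0.
Proof.
move=> hk; apply/eqP => s0; apply: hk; exists (Num.floor (alpha / pi)).
set k := Num.floor _.
have p0 := pi_gt0 R.
have /andP[k1 k2] : k%:~R <= alpha / pi < (k + 1)%:~R by exact: floor_itv.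
have := sin_mulrz_pi R k => sk.
have ck : cos (k%:~R * pi) != 0 :> R.
  by apply: contraTN isT => /eqP c0; have := cos2Dsin2 (k%:~R * pi : R); rewrite c0 sk !expr0n addr0 => /eqP; rewrite eq_sym oner_eq0.
pose x := alpha - k%:~R * pi.
have x0 : 0 <= x by rewrite subr_ge0 -ler_pdivlMr.
have xp : x < pi.
  by rewrite /x ltrBlDr addrC -[X in _ + X]mul1r -mulrDl -ltr_pdivrMr// -intrD1.
have sx : sin x = 0 by rewrite /x sinB s0 sk mul0r mulr0 subr0.
apply/eqP; rewrite -subr_eq0 -/x eq_le x0 andbT leNgt; apply/negP => xgt.
by have := @sin_gt0_pi R x; rewrite xgt xp sx ltxx => /(_ isT).
Qed.

Unset Implicit Arguments.
Set Strict Implicit.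

Theorem mainTheorem2 (R : realType) (alpha rho : R) (z : R[i])
    (halpha : ~ exists k : int, alpha = k%:~R * pi)
    (hrho : rho <> 0) (hz : z = rho%:C * 'i%C) :
  (forall f g : R -> R[i], in_Lp 2%:E f -> in_Lp 2%:E g ->
     inner (O_L2 alpha z f) (O_L2 alpha z g)
       = 4^-1 * (1 + `|z| ^+ 2) * inner f g) /\
  (forall f : R -> R[i], in_Lp 2%:E f ->
     (cLnorm 2%:E (O_L2 alpha z f) ^+ 2
       = (4^-1 * (1 + Normc.normc z ^+ 2))%R%:E * cLnorm 2%:E f ^+ 2)%E).
Proof.
have sa := sin_neq0 halpha.
pose T := O_L2 alpha z.
have hT : is_L2_extension alpha z T.
  (* Existence of some extension ensures that [xget] returns an extension and not its zero
     default. *)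
  have [T0 hT0] := exists_L2_extension rho sa.
  by rewrite /T /O_L2 hz; apply: (xgetPex _ (P := [set T | is_L2_extension _ _ T])); exists T0.
have LT f : L2 f -> L2 (T f) by move=> Lf; apply/in_L2P; apply: (let: And3 h _ _ := hT in h); apply/in_L2P.
pose k : R := 4^-1 * (1 + rho ^+ 2).
have iso f g w : L2 f -> L2 g -> n2 (fun s => T f s + w * T g s) = k * n2 (fun t => f t + w * g t).
  by move: hT; rewrite hz; exact: L2_extension_isometry.
have nz : nsq z = rho ^+ 2 by rewrite hz /nsq /=; ring.
split=> [f g /in_L2P Lf /in_L2P Lg|f /in_L2P Lf].
  rewrite !inner_polarization//; try exact: LT.
  rewrite -/T !iso// -add_Re2_Im2 -/(nsq z) nz.
  (* The scalar of the statement lives in R[i]; once seen as the real [k], it acts on real and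
     imaginary parts separately. *)
  have -> : 4^-1 * (1 + (rho ^+ 2)%:C) = k%:C.
    by rewrite [RHS]rmorphM/= [X in _ = _ * X]rmorphD/= rmorph1 fmorphV rmorph_nat.
  by apply/eqP; rewrite eq_complex /=; apply/andP; split; apply/eqP; ring.
rewrite -/T !cLnorm2_sqr sqr_normc_nsq nz -/k.
have [_ i1] := LT _ Lf; have [_ i2] := Lf.
rewrite -!EFin_Rintegral// -EFinM; congr EFin.
(* The scalar w = 0 reduces the two-function isometry to the norm of T f. *)
have := iso f f 0 Lf Lf.
by under eq_fun do rewrite mul0r addr0; under [in RHS]eq_fun do rewrite mul0r addr0.
Qed.
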